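(* Let $H=H(x,r,p):\mathbb{T}^n\times\mathbb{R}\times\mathbb{R}^n\to\mathbb{R}$ be continuous. Assume that: (i) there exists a constant $C_1>0$ such that $|H(x,r,p)-H(x,s,p)|\le C_1|r-s|$ for all $(x,p)\in\mathbb{T}^n\times\mathbb{R}^n$ and $r,s\in\mathbb{R}$; (ii) $\lim_{|p|\to\infty}\frac{H(x,0,p)}{|p|}=+\infty$ uniformly for $x\in\mathbb{T}^n$. Then there exists a pair $(v,c)\in\mathrm{Lip}(\mathbb{T}^n)\times\mathbb{R}$ such that $v$ is a viscosity solution of $$H(x,v,Dv)=c\quad\text{in }\mathbb{T}^n .$$
   Context: $\mathbb{T}^n=\mathbb{R}^n/\mathbb{Z}^n$ is the flat $n$-dimensional torus, $\mathrm{Lip}(\mathbb{T}^n)$ is the set of Lipschitz functions on $\mathbb{T}^n$, and $Dv$ is the spatial gradient of $v$. Solutions are in the viscosity sense. *)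

(* Defs.v *)
From HB Require Import structures.
From mathcomp Require Import all_boot all_order all_algebra.
From mathcomp Require Import generic_quotient.
From mathcomp Require Import all_classical all_reals all_analysis.
Set Implicit Arguments.
Unset Strict Implicit.
Unset Printing Implicit Defensive.
Import Order.TTheory GRing.Theory Num.Theory.
Import numFieldNormedType.Exports.
Local Open Scope classical_set_scope.
Local Open Scope quotient_scope.
Local Open Scope ring_scope.

Section Torus.
Context (R : realType) (n : nat).

(* The library norm on ['rV[R]_n] is the maximum norm. *)
Definition enorm (p : 'rV[R]_n) : R := Num.sqrt (\sum_i p 0 i ^+ 2).

Definition zcongr (x y : 'rV[R]_n) : bool :=
  [forall i, x 0 i - y 0 i \is a Num.int].

Fact zcongr_refl : reflexive zcongr.
Proof. by move=> x; apply/forallP => i; rewrite subrr rpred0. Qed.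

Fact zcongr_sym : symmetric zcongr.
Proof. by move=> x y; apply: eq_forallb => i; rewrite -rpredN opprB. Qed.

Fact zcongr_trans : transitive zcongr.
Proof.
move=> y x z /forallP xy /forallP yz; apply/forallP => i.
by rewrite -(subrKA (y 0 i)) rpredD.
Qed.

Canonical zcongr_equiv := EquivRel zcongr zcongr_refl zcongr_sym zcongr_trans.

Definition torus : Type := quotient_topology {eq_quot zcongr_equiv}.

HB.instance Definition _ := Topological.on torus.
HB.instance Definition _ := Quotient.on torus.

Definition torus_proj : 'rV[R]_n -> torus := \pi_torus.

Definition lift (phi : torus -> R) : 'rV[R]_n -> R := phi \o torus_proj.

Definition torus_dist (x y : torus) : R :=
  inf [set enorm (a - b) | a in torus_proj @^-1` [set x]
                         & b in torus_proj @^-1` [set y]].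

Definition torus_lipschitz (v : torus -> R) : Prop :=
  exists L : R, forall x y, `|v x - v y| <= L * torus_dist x y.

Definition grad (f : 'rV[R]_n -> R) (x : 'rV[R]_n) : 'rV[R]_n :=
  \row_i 'D_(delta_mx 0 i) f x.

(* The lift of [phi] is periodic, so the choice of representative is
   immaterial. *)
Definition torus_grad (phi : torus -> R) (x : torus) : 'rV[R]_n :=
  grad (lift phi) (repr x).

Definition torus_C1 (phi : torus -> R) : Prop :=
  (forall a, differentiable (lift phi) a) /\ continuous (grad (lift phi)).

Definition local_max (f : torus -> R) (x : torus) : Prop :=
  \forall y \near x, f y <= f x.

Definition local_min (f : torus -> R) (x : torus) : Prop :=
  \forall y \near x, f x <= f y.

Definition viscosity_subsolution (H : torus -> R -> 'rV[R]_n -> R) (c : R)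
    (u : torus -> R) : Prop :=
  forall (phi : torus -> R) (x : torus), torus_C1 phi ->
    local_max (fun y => u y - phi y) x -> H x (u x) (torus_grad phi x) <= c.

Definition viscosity_supersolution (H : torus -> R -> 'rV[R]_n -> R) (c : R)
    (u : torus -> R) : Prop :=
  forall (phi : torus -> R) (x : torus), torus_C1 phi ->
    local_min (fun y => u y - phi y) x -> c <= H x (u x) (torus_grad phi x).

Definition viscosity_solution (H : torus -> R -> 'rV[R]_n -> R) (c : R)
    (u : torus -> R) : Prop :=
  [/\ continuous u, viscosity_subsolution H c u
    & viscosity_supersolution H c u].

End Torus.

(* Main.v *)
(* The equation is discretized on the lattice of mesh 1/m. The scheme evaluates a
   truncation of H at the mean of the backward and forward difference quotients,
   adds a numerical viscosity made of the modulus of continuity of H in p, and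
   penalizes slopes larger than L. As H is not monotone in r, there is no
   comparison principle and a discrete pair (V, c) has to come from a topological
   argument: Scarf's lemma, applied to the nonnegative grid functions of prescribed
   mean labelled by a point where the scheme is least, gives a V such that the
   scheme takes its least value c wherever V > 0. The penalty bounds the slopes of V;
   if the mean is large enough this forces V > 0, so that the scheme equals c at
   every point of the lattice. The functions V are equi-Lipschitz and bounded, so
   they converge along an ultrafilter to a Lipschitz v, and c converges as well. The
   scheme compares well enough with C^1 test functions to make v a viscosity
   solution of the truncated equation, and the superlinear growth of H allows the
   truncation and the penalty to be chosen so large that they are not seen. *)
Require Import Defs.
From mathcomp Require Import all_boot all_order all_algebra.
Set Implicit Arguments.
Unset Strict Implicit.
Unset Printing Implicit Defensive.

(** * Scarf's lemma *)

(** Since [C] has one element more than its image, exactly one pair of indices shares a value;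
    dropping an index keeps the image iff it is one of these two. *)
Lemma card_redundant (I Z : finType) (f : I -> Z) (C : {set I}) (s : {set Z}) :
  f @: C = s -> #|C| = #|s|.+1 ->
  #|[set k in C | f @: (C :\ k) == s]| = 2.
Proof.
move=> fC cC.
have /dinjectivePn[i iC [j /andP[ji jC] fij]] : ~~ dinjectiveb f (mem C).
  apply/negP => /dinjectiveP inj.
  by have := card_in_imset inj; rewrite fC cC => /n_Sn.
have cov a b : a \in C -> b \in C -> a != b -> f a = f b -> f @: (C :\ a) = s.
  move=> aC bC ab fab; apply/eqP; rewrite eqEsubset -fC imsetS ?subsetDl//=.
  apply/subsetP => _ /imsetP[x xC ->]; have [->|xa] := eqVneq x a.
    by rewrite fab imset_f// !inE eq_sym ab.
  by rewrite imset_f// !inE xa.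
rewrite (_ : [set k in C | _] = [set i; j]); first by rewrite cards2 eq_sym ji.
apply/setP => k; rewrite !inE; apply/andP/orP; last first.
  case=> /eqP->; split=> //; apply/eqP; first by apply: (cov _ j) => //; rewrite eq_sym.
  exact: (cov _ i).
case=> kC /eqP fk; apply/orP; apply: contraT; rewrite negb_or => /andP[ki kj].
have : f @: (C :\ k :\ i) = s.
  apply/eqP; rewrite eqEsubset -{1}fk imsetS ?subsetDl//= -fk.
  apply/subsetP => _ /imsetP[x xC ->]; have [->|xi] := eqVneq x i.
    by rewrite fij imset_f// !inE ji jC eq_sym kj.
  by move: xC; rewrite !inE => /andP[xk xC]; rewrite imset_f// !inE xi xk.
move=> /(congr1 (fun t => #|pred_of_set t|)) e.
have := leq_imset_card f (mem (C :\ k :\ i)); rewrite e.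
have := cardsD1 k C; have := cardsD1 i (C :\ k); rewrite kC !inE eq_sym ki iC cC /=.
by move=> -> [->]; rewrite add1n ltnn.
Qed.

(** * Dominating sets and their one-element extensions *)

Section Dominating.
Context (I Z : finType) (rk : I -> Z -> nat).
Hypothesis rk_inj : forall i, injective (rk i).

(** Scarf's notion: for nonempty [t], no [z] lies strictly above the least element of [t] in all
    orders at once. *)
Definition dominating (t : {set Z}) :=
  [forall z, exists i, forall x in t, rk i z <= rk i x].

Lemma dominatingP (t : {set Z}) :
  reflect (forall z, exists i, forall x, x \in t -> rk i z <= rk i x)
          (dominating t).
Proof.
apply: (iffP forallP) => h z.
  by have /existsP[i /forall_inP hi] := h z; exists i.
by have [i hi] := h z; apply/existsP; exists i; apply/forall_inP.
Qed.

Lemma dominatingS (s t : {set Z}) : s \subset t -> dominating t -> dominating s.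
Proof.
move=> /subsetP st /dominatingP dt; apply/dominatingP => z.
by have [i hi] := dt z; exists i => x /st; exact: hi.
Qed.

(* [f i] is the least element of [s] for the order [i].  Since [s] is
   dominating, [f] is onto [s], hence identifies exactly two indices; dropping
   either one leaves room for exactly one new element, the greatest among those
   lying above [s] in all the other orders. *)
Lemma card_dominating_extension (s : {set Z}) :
  #|I| = #|s|.+1 -> dominating s -> s != set0 ->
  (forall k, exists z, forall l, l != k -> exists2 x, x \in s & rk l x < rk l z) ->
  #|[set y | (y \notin s) && dominating (y |: s)]| = 2.
Proof.
move=> cI /dominatingP ds /set0Pn[x0 x0s] top.
pose f i := [arg min_(x < x0 in s) rk i x].
have fs i : f i \in s by rewrite /f; case: arg_minnP.
have fmin i x : x \in s -> rk i (f i) <= rk i x.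
  by rewrite /f; case: arg_minnP => // y _ + xs; apply.
have fI : f @: setT = s.
  apply/eqP; rewrite eqEsubset; apply/andP; split; apply/subsetP.
    by move=> _ /imsetP[i _ ->].
  move=> x xs; have [i hi] := ds x; apply/imsetP; exists i => //.
  by apply: (rk_inj (i := i)); apply/eqP; rewrite eqn_leq hi// fmin.
pose K := [set k in setT | f @: (setT :\ k) == s].
have cK : #|K| = 2 by apply: card_redundant; rewrite ?cardsT.
pose Y k y := [forall l, (l != k) ==> (rk l (f l) < rk l y)].
have YP k y : reflect (forall l, l != k -> rk l (f l) < rk l y) (Y k y).
  by apply: (iffP forallP) => h l; [apply/implyP|apply/implyP => /h].
have Yex k : exists z, Y k z.
  have [z hz] := top k; exists z; apply/YP => l /hz[x xs].
  exact: leq_ltn_trans (fmin _ _ xs).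
have /fin_all_exists[t tP] : forall k, exists z,
    Y k z /\ forall y, Y k y -> rk k y <= rk k z.
  move=> k; have [z0 hz0] := Yex k.
  by case: (arg_maxnP (rk k) hz0) => z; exists z.
have notY y : exists i, rk i y <= rk i (f i).
  by have [i hi] := ds y; exists i; apply: hi.
rewrite -cK; suff -> : [set y | (y \notin s) && dominating (y |: s)] = t @: K.
  apply: card_in_imset => k k' kK k'K tkk'; apply/eqP; apply: contraT => kk'.
  have [i] := notY (t k); rewrite leqNgt; have [ik|ik] := eqVneq i k.
    by have [/YP/(_ i)] := tP k'; rewrite -tkk' ik => -> //.
  by have [/YP/(_ i ik) ->] := tP k.
apply/setP => y; rewrite inE; apply/andP/imsetP; last first.
  case=> k; rewrite !inE => /eqP kK ->; have [/YP tk1 tk2] := tP k.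
  split.
    apply/negP; rewrite -kK => /imsetP[l]; rewrite !inE andbT => /tk1 + e.
    by rewrite e ltnn.
  apply/dominatingP => z; have [i zi] := notY z.
  have [ik|ik] := eqVneq i k; last first.
    have [z1|z1] := boolP (rk i z <= rk i (t k)).
      exists i => x; rewrite !inE => /orP[/eqP->//|xs].
      exact: leq_trans zi (fmin _ _ xs).
    by case/negP: z1; apply: leq_trans zi (ltnW (tk1 _ ik)).
  have [/forall_inP h|] := boolP [forall (l | l != k), rk l (f l) < rk l z].
    exists k => x; rewrite !inE => /orP[/eqP->|xs].
      by apply: tk2; apply/YP.
    by rewrite -ik; apply: leq_trans zi (fmin _ _ xs).
  rewrite negb_forall => /existsP[l]; rewrite negb_imply -leqNgt => /andP[lk zl].
  exists l => x; rewrite !inE => /orP[/eqP->|xs].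
    exact: leq_trans zl (ltnW (tk1 _ lk)).
  exact: leq_trans zl (fmin _ _ xs).
case=> ys /dominatingP dy; have [k yk] := notY y.
have {}yk x : x \in s -> rk k y < rk k x.
  move=> xs; rewrite ltn_neqAle (leq_trans yk (fmin _ _ xs)) andbT.
  by apply: contra ys => /eqP/rk_inj ->.
have back (D : {set I}) : (forall l, l \notin D -> rk l y < rk l (f l)) -> f @: D = s.
  move=> hD; apply/eqP; rewrite eqEsubset; apply/andP; split; apply/subsetP.
    by move=> _ /imsetP[i _ ->].
  move=> x xs; have [i hi] := dy x; apply/imsetP; exists i.
    apply: contraT => /hD; rewrite ltnNge => /negP; case.
    by apply: leq_trans (hi y _); [exact: fmin|rewrite !inE eqxx].
  apply: (rk_inj (i := i)); apply/eqP; rewrite eqn_leq fmin// andbT.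
  by apply: hi; rewrite !inE fs orbT.
(* If [y] were also below [f l] for some [l] other than [k], then by [back] the indices without [k]
   and [l] would still map onto [s], which has more elements than they are. *)
have Yk : Y k y.
  apply/YP => l lk; rewrite ltnNge; apply/negP => yl.
  have : f @: (setT :\ k :\ l) = s.
    apply: back => j; rewrite !inE andbT -negb_or negbK => /orP[] /eqP ->.
      rewrite ltn_neqAle yl andbT; apply: contra ys => /eqP/rk_inj ->; exact: fs.
    exact: yk.
  move=> /(congr1 (fun t => #|pred_of_set t|)) e.
  have := leq_imset_card f (mem (setT :\ k :\ l)); rewrite e.
  have := cardsD1 k setT; have := cardsD1 l (setT :\ k).
  by rewrite !inE lk cardsT cI /= => -> [->]; rewrite add1n ltnn.
have [tk1 tk2] := tP k.
exists k.
  rewrite !inE; apply/eqP; apply: back => l; rewrite !inE andbT negbK => /eqP ->.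
  exact: yk.
apply: (rk_inj (i := k)); apply/eqP; rewrite eqn_leq tk2// andTb.
have [i hi] := dy (t k); have [ik|ik] := eqVneq i k.
  by move: (hi y); rewrite ik !inE eqxx; apply.
have := hi (f i); rewrite !inE fs orbT => /(_ isT).
by rewrite leqNgt; move/YP: tk1 => ->.
Qed.
End Dominating.

(** * Slack elements, parity count and Scarf's lemma *)

Section Scarf.
Context (I X : finType) (rk : I -> X -> nat) (col : X -> I).
Hypothesis rk_inj : forall i, injective (rk i).

Let M := \max_i \max_x (rk i x).+2.

Let rkM i x : (rk i x).+1 < M.
Proof.
by apply: leq_trans (leq_bigmax i); apply: (leq_bigmax (F := fun x => (rk i x).+2)).
Qed.

(* The slack element [inr i] is the least one in the order [i] and lies above
   all of [X] in the other orders. *)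
Definition slack_rk (i : I) (z : X + I) : nat :=
  match z with
  | inl x => (rk i x).+1
  | inr j => if j == i then 0 else (M + enum_rank j).+1
  end.

Definition slack_col (z : X + I) : I :=
  match z with inl x => col x | inr j => j end.

Lemma slack_rk_inj i : injective (slack_rk i).
Proof.
have MS n : ((M + n).+1 < M) = false.
  by apply/negbTE; rewrite -leqNgt leqW// leq_addr.
move=> [x|j] [y|k] /=.
- by case=> /rk_inj ->.
- by case: eqP => // _ e; have := rkM i x; rewrite e MS.
- by case: eqP => // _ e; have := rkM i y; rewrite -e MS.
- case: eqP => [->|_]; case: eqP => [->|_] //.
  by case=> /addnI /ord_inj /enum_rank_inj ->.
Qed.

Lemma slack_rk_top i j x : j != i -> slack_rk i (inl x) < slack_rk i (inr j).
Proof.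
by move=> /negbTE /= ->; apply: leqW; apply: leq_trans (rkM i x) (leq_addr _ _).
Qed.

Lemma slack_rk0 i : slack_rk i (inr i) = 0.
Proof. by rewrite /= eqxx. Qed.

Local Notation slacks m := (inr @: [set~ m] : {set X + I}).

Lemma dominating_slacks m : dominating slack_rk (slacks m).
Proof.
apply/dominatingP => -[x|j].
  exists m => _ /imsetP[j jm ->]; apply: ltnW; apply: slack_rk_top.
  by move: jm; rewrite !inE.
by exists j => y _; rewrite slack_rk0.
Qed.

(** In every order other than [m] the set contains the slack element of rank 0, so a new element of
    [X] must dominate through the order [m] and be the greatest one there. Adding [inr m] would
    leave no order for the elements of [X]. *)
Lemma card_dominating_slacks_extension m (x0 : X) :
  #|[set y | (y \notin slacks m) && dominating slack_rk (y |: slacks m)]| = 1.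
Proof.
have [xm _ xm_max] := arg_maxnP (rk m) (isT : xpredT x0).
have xmP x : rk m x <= rk m xm by exact: xm_max.
rewrite (_ : [set y | _] = [set inl xm]) ?cards1//.
have inl_slack x : inl x \notin slacks m by apply/negP => /imsetP[].
have no_slack (t : {set X + I}) i x : inr i \in t ->
    ~ (forall z, z \in t -> slack_rk i (inl x) <= slack_rk i z).
  by move=> it /(_ _ it); rewrite slack_rk0.
apply/setP => y; rewrite !inE; apply/andP/eqP => [[ys /dominatingP dy]|->].
  have {ys} : exists x, y = inl x.
    case: y ys dy => [x|j] ys dy; first by exists x.
    have jm : j = m.
      apply/eqP; apply: contraNT ys => jm; apply: imset_f; by rewrite !inE.
    have [i /no_slack[]] := dy (inl x0); rewrite !inE jm.
    by have [->|im] := eqVneq i m; rewrite ?eqxx// imset_f ?orbT// !inE.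
  case=> x yx; rewrite yx in dy *; have [i hi] := dy (inl xm).
  have im : i = m.
    apply/eqP; apply: contraT => im; case: (no_slack _ _ _ _ hi).
    by rewrite in_setU imset_f ?orbT// !inE.
  congr inl; apply: (rk_inj (i := m)); apply/eqP; rewrite eqn_leq xmP//=.
  by have := hi (inl x); rewrite im !inE eqxx; apply.
split=> //; apply/dominatingP => -[x|j]; last by exists j => z _; rewrite slack_rk0.
exists m => z; rewrite in_setU1 => /orP[/eqP->|]; first by rewrite /= ltnS xmP.
case/imsetP=> j jm ->; apply: ltnW; apply: slack_rk_top.
by move: jm; rewrite !inE.
Qed.

(* Parity count of the inclusions [s \subset t] between the dominating sets [s]
   of size [#|I| - 1] with all colours but [m] and the dominating sets [t] of
   size [#|I|]: if no [t] had all the colours, every [t] would occur an even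
   number of times, whereas every [s] occurs twice, except for the set of all
   the slack elements other than [inr m], which occurs once. *)
Lemma exists_rainbow (x0 : X) (m : I) :
  exists t : {set X + I}, dominating slack_rk t /\ slack_col @: t = setT.
Proof.
pose T := [set t : {set X + I} | dominating slack_rk t & #|t| == #|I|].
pose D := [set s : {set X + I} |
  [&& dominating slack_rk s, #|s|.+1 == #|I| & slack_col @: s == [set~ m]]].
have [/exists_inP[t tT /eqP ct]|noT] :=
    boolP [exists t in T, slack_col @: t == setT].
  by exists t; move: tT; rewrite inE => /andP[].
have cm : #|I| = #|[set~ m]|.+1.
  by rewrite -cardsT (cardsD1 m) inE add1n -setTD.
have cD (s : {set X + I}) : s \in D -> #|[set t in T | s \subset t]| =
    #|[set y | (y \notin s) && dominating slack_rk (y |: s)]|.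
  rewrite inE => /and3P[_ /eqP cs _].
  rewrite -(card_in_imset (f := fun y => y |: s)); last first.
    move=> y z; rewrite !inE => /andP[ys _] /andP[zs _] /setP/(_ y).
    by rewrite !inE eqxx (negbTE ys) !orbF => /esym/eqP.
  apply: eq_card => t; rewrite !inE; apply/andP/imsetP.
    case=> /andP[dt /eqP ct] st.
    have /cards1P[y yt] : #|t :\: s| == 1.
      by rewrite cardsD (setIidPr st) ct -cs subSn// subnn.
    have ty : t = y |: s by rewrite -yt setUC -{1}(setIidPr st) setID.
    exists y => //; rewrite inE -ty dt andbT.
    by have : y \in t :\: s; [rewrite yt set11|rewrite inE => /andP[]].
  case=> y; rewrite inE => /andP[ys dy] ->; split; last exact: subsetUr.
  by rewrite dy cardsU1 ys add1n cs eqxx.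
have sD : slacks m \in D.
  rewrite inE dominating_slacks card_imset; last by move=> ? ? [].
  rewrite cm eqxx /=; apply/eqP/setP => j.
  apply/imsetP/idP => [[_ /imsetP[k km ->] ->//]|jm].
  by exists (inr j) => //; apply: imset_f.
have evenT : ~~ odd (\sum_(t in T) #|[set s in D | s \subset t]|).
  elim/big_rec: _ => // t n tT en; rewrite oddD (negbTE en) addbF.
  move: (tT); rewrite inE => /andP[dt /eqP ct].
  have [tm|tm] := eqVneq (slack_col @: t) [set~ m].
    have <- : #|[set k in t | slack_col @: (t :\ k) == [set~ m]]| =
        #|[set s in D | s \subset t]|; last by rewrite (card_redundant tm)// ct.
    rewrite -(card_in_imset (f := fun k => t :\ k)); last first.
      move=> y z; rewrite !inE => /andP[yt _] /andP[zt _] /setP/(_ y).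
      by rewrite !inE eqxx yt !andbT => /esym/negbFE/eqP.
    apply: eq_card => s; rewrite !inE; apply/imsetP/andP.
      case=> k; rewrite inE => /andP[kt ck] ->; split; last exact: subsetDl.
      rewrite ck (dominatingS (subsetDl _ _) dt) andbT /=.
      by rewrite -ct (cardsD1 k t) kt.
    case=> /and3P[ds /eqP cs ms] st.
    have /cards1P[y yt] : #|t :\: s| == 1.
      by rewrite cardsD (setIidPr st) ct -cs subSn// subnn.
    have ty : s = t :\ y by rewrite -yt setDDr setDv set0U (setIidPr st).
    exists y => //; rewrite inE -ty ms andbT.
    by have : y \in t :\: s; [rewrite yt set11|rewrite inE => /andP[]].
  rewrite (_ : [set s in D | _] = set0) ?cards0//; apply/setP => s; rewrite !inE.
  apply/negP => /andP[/and3P[_ _ /eqP cs] st].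
  case/negP: noT; apply/exists_inP; exists t => //.
  have := imsetS slack_col st; rewrite cs => mt.
  rewrite eqEsubset subsetT /= -(setUCr [set m]) subUset mt andbT sub1set.
  apply: contraNT tm => mt'; rewrite eqEsubset mt andbT.
  apply/subsetP => j jt; rewrite !inE; apply: contra mt' => /eqP <- //.
have oddD : odd (\sum_(s in D) #|[set t in T | s \subset t]|).
  rewrite (bigD1 _ sD) /= cD// card_dominating_slacks_extension// oddD addTb.
  elim/big_rec: _ => // s n /andP[sD' ns] en; rewrite oddD (negbTE en) addbF.
  rewrite cD//; have := (sD' : s \in D); rewrite inE => /and3P[ds /eqP cs /eqP ms].
  (* A member of [D] made of slack elements only is [slacks m]. Any other contains an element of
     [X], above which [inr k] lies in all orders but [k], as the extension lemma requires. *)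
  have /existsP[x xs] : [exists x, inl x \in s].
    apply: contraNT ns; rewrite negb_exists => /forallP h; apply/eqP.
    have sS : s \subset slacks m.
      apply/subsetP => -[x|j] js; first by have := h x; rewrite js.
      by apply: imset_f; rewrite -ms; apply/imsetP; exists (inr j).
    apply/eqP; rewrite eqEcard sS card_imset; last by move=> ? ? [].
    by move: cm; rewrite -cs => -[->]; rewrite leqnn.
  rewrite card_dominating_extension//; first exact: slack_rk_inj.
    by apply/set0Pn; exists (inl x).
  move=> k; exists (inr k) => l lk; exists (inl x) => //.
  by apply: slack_rk_top; rewrite eq_sym.
suff swap : \sum_(s in D) #|[set t in T | s \subset t]| =
    \sum_(t in T) #|[set s in D | s \subset t]|.
  by move: oddD; rewrite swap => o; rewrite o in evenT.
under eq_bigr do rewrite -sum1dep_card.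
under [RHS]eq_bigr do rewrite -sum1dep_card.
rewrite (exchange_big_dep (mem T)) /=; last by move=> ? ? _ /andP[].
by apply: eq_bigr => t tT; apply: eq_bigl => s; rewrite tT.
Qed.

(** Let [C] be the set of indices whose slack is missing from a rainbow set: a colour in [C] can
    only come from an element of [X]. A slack that is present has rank 0 in its own order, so
    elements of [X] are dominated through an order in [C]. *)
Lemma scarf (x0 : X) (m : I) : exists (s : {set X}) (C : {set I}),
  (forall i, i \in C -> exists2 x, x \in s & col x = i) /\
  (forall y, exists2 i, i \in C & forall x, x \in s -> rk i y <= rk i x).
Proof.
have [t [/dominatingP dt ct]] := exists_rainbow x0 m.
exists [set x | inl x \in t], [set i | inr i \notin t]; split=> [i|y].
  rewrite inE => it; have : i \in slack_col @: t by rewrite ct.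
  case/imsetP=> -[x|j] jt /= e; first by exists x; rewrite ?inE.
  by rewrite e jt in it.
have [i hi] := dt (inl y); exists i.
  by rewrite inE; apply/negP => /hi; rewrite slack_rk0.
by move=> x; rewrite inE => /hi.
Qed.

End Scarf.

(** A discrete counterpart of the Knaster-Kuratowski-Mazurkiewicz lemma: Scarf's lemma for the
    lattice points of a simplex, ordered by their coordinates. The points of the set found lie
    within [#|I|] of each other in each coordinate, and any of them serves as [x]. *)
Lemma lattice_simplex_labelling (I : finType) (i1 : I) (T : nat)
    (col : (I -> nat) -> I) :
  exists x : I -> nat, \sum_i x i = T /\ forall i, #|I| < x i ->
    exists y : I -> nat, [/\ \sum_i y i = T, col y = i &
      forall j, x j <= y j + #|I| /\ y j <= x j + #|I|].
Proof.
pose W := {ffun I -> 'I_T.+1}; pose X := {w : W | \sum_i w i == T}.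
(* Ties in the [i]-th coordinate are broken arbitrarily. *)
pose rk i (x : X) := val x i * #|W| + enum_rank (val x).
have rk_le i (x y : X) : rk i x <= rk i y -> val x i <= val y i.
  rewrite /rk leqNgt => h; rewrite leqNgt; apply: contra h => yx.
  apply: (@leq_trans ((val y i).+1 * #|W|)).
    by rewrite mulSn addnC ltn_add2r.
  by apply: leq_trans (leq_addr _ _); rewrite leq_mul2r yx orbT.
have rk_inj i : injective (rk i).
  move=> x y e; have xy : val x i = val y i :> nat.
    by apply/eqP; rewrite eqn_leq !rk_le// e.
  apply/val_inj/enum_rank_inj/val_inj; apply/eqP.
  by move/eqP: e; rewrite /rk xy eqn_add2l.
have mkX (f : I -> nat) : \sum_i f i = T -> exists x : X, forall i, val x i = f i :> nat.
  move=> fT; have fi i : f i < T.+1 by rewrite ltnS -fT (bigD1 i)//= leq_addr.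
  have h : \sum_i [ffun i => Ordinal (fi i)] i == T.
    by apply/eqP; rewrite -[RHS]fT; apply: eq_bigr => i _; rewrite ffunE.
  by exists (exist (fun w : W => \sum_i w i == T) _ h) => i; rewrite ffunE.
have sum1 a : \sum_i (if i == i1 then a else 0) = a.
  by rewrite -big_mkcond big_pred1_eq.
have [x0 _] : exists x : X, forall i, val x i = (if i == i1 then T else 0) :> nat.
  by apply: mkX.
have [s [C [sC domC]]] := scarf (fun x : X => col (fun i => val x i)) rk_inj x0 i1.
have [z zs] : exists z, z \in s.
  by have [i /sC[z zs _] _] := domC x0; exists z.
pose mu i := if i \in C then nat_of_ord (val [arg min_(x < z in s) (val x i)] i) else 0.
have mu_le i x : x \in s -> mu i <= val x i.
  by move=> xs; rewrite /mu; case: ifP => // _; case: arg_minnP => // y _; apply.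
(* Otherwise some lattice point of total [T] would lie strictly above [mu] in all directions of [C],
   the surplus being put on [i1], against domination. *)
have sum_mu : T <= \sum_i mu i + #|I|.
  pose f i := mu i + (i \in C).
  have fI : \sum_i f i <= \sum_i mu i + #|I|.
    by rewrite big_split leq_add2l -[leqRHS]sum1_card leq_sum// => i _; case: (_ \in _).
  apply: leq_trans fI; rewrite leqNgt; apply/negP => fT.
  have [y yE] : exists y : X, forall i,
      val y i = f i + (if i == i1 then T - \sum_i f i else 0) :> nat.
    apply: mkX; rewrite big_split/= sum1 subnKC//; exact: ltnW.
  have [i iC hi] := domC y; pose w := [arg min_(x < z in s) (val x i)].
  have ws : w \in s by rewrite /w; case: arg_minnP.
  have := rk_le _ _ _ (hi w ws); rewrite yE /f /mu iC leqNgt.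
  by rewrite (leq_trans _ (leq_addr _ _))// addn1.
have le_mu i x : x \in s -> val x i <= mu i + #|I|.
  move=> xs; have /eqP xT := valP x.
  have : \sum_(j | j != i) mu j <= \sum_(j | j != i) val x j.
    by apply: leq_sum => j _; exact: mu_le.
  have : \sum_i nat_of_ord (val x i) <= \sum_i mu i + #|I| by rewrite xT.
  have -> : \sum_i mu i = mu i + \sum_(j | j != i) mu j by rewrite (bigD1 i).
  have -> : \sum_i nat_of_ord (val x i) = val x i + \sum_(j | j != i) val x j.
    by rewrite (bigD1 i).
  move: (\sum_(j | _) mu j) (\sum_(j | _) _) => b a h ab.
  rewrite -(leq_add2r a) (leq_trans h)// -addnA [b + _]addnC addnA.
  by rewrite leq_add2l.
exists (fun i => nat_of_ord (val z i)); split; first exact/eqP/(valP z).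
move=> i zi; have iC : i \in C.
  apply: contraTT zi => /negbTE iC.
  by rewrite -leqNgt (leq_trans (le_mu _ _ zs))// /mu iC.
have [y ys <-] := sC i iC; exists (fun i => nat_of_ord (val y i)); split=> //.
  exact/eqP/(valP y).
by move=> j; split; apply: leq_trans (le_mu _ _ _) _ => //; rewrite leq_add2r mu_le.
Qed.

From mathcomp Require Import generic_quotient.
From mathcomp Require Import all_classical all_reals all_analysis.
From mathcomp Require Import ring lra zify.
Import Order.TTheory GRing.Theory Num.Theory.
Import numFieldNormedType.Exports.
Local Open Scope classical_set_scope.
Local Open Scope ring_scope.

(** * Limits along an ultrafilter *)

Section Ultralimits.
Context (U : set_system nat) (UU : UltraFilter U) (Uoo : \oo `<=` U).

(** An ultrafilter contains each set or its complement, so a cluster point is a limit. This takes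
    the place of the extraction of subsequences. *)
Lemma ultra_cvg_compact (T : topologicalType) (A : set T) (u : nat -> T) :
  compact A -> (\forall k \near U, A (u k)) -> exists2 l, A l & u @ U --> l.
Proof.
move=> cA uA; have [l [Al cl]] := cA (u @ U) _ uA; exists l => //.
move=> B Bl; have [//|nB] := in_ultra_setVsetC (u @^-1` B) UU.
by have [x [/= nBx]] := cl (~` B) B nB Bl.
Qed.

Lemma ultra_cvg_itv (R : realType) (a b : R) (u : nat -> R) :
  (forall k, a <= u k <= b) -> exists2 l, a <= l <= b & u @ U --> l.
Proof.
move=> uab; have uA : \forall k \near U, `[a, b]%classic (u k).
  by apply: nearW => k; rewrite /= in_itv/= uab.
have [l] := ultra_cvg_compact (@segment_compact R a b) uA.
by rewrite /= in_itv/=; exists l.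
Qed.

Lemma cvg_oo_ultra (T : topologicalType) (u : nat -> T) l :
  u @ \oo --> l -> u @ U --> (l : T).
Proof. by move=> h B Bl; apply: Uoo; exact: h. Qed.

(** The labelling lemma is applied on finer and finer lattices of the simplex, a point being
    labelled by an index where [F] is least. Where [v i] is positive, points labelled [i] converge
    to [v], and continuity gives the inequality. *)
Lemma variational_inequality (R : realType) (I : finType) (i0 : I)
    (F : I -> (I -> R) -> R) (S : R) : 0 < S ->
  (forall (u : nat -> I -> R) (v : I -> R),
     (forall i, u k i @[k --> U] --> v i) ->
     forall i, F i (u k) @[k --> U] --> F i v) ->
  exists v : I -> R, [/\ forall i, 0 <= v i, \sum_i v i = S &
    forall i j, 0 < v i -> F i v <= F j v].
Proof.
move=> S0 cF.
pose sc (T : nat) (x : I -> nat) i : R := S / T.+1%:R * (x i)%:R.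
have /choice[lab labP] : forall v : I -> R, exists i, forall j, F i v <= F j v.
  move=> v; exists [arg min_(i < i0) F i v]%O.
  by case: arg_minP => // i _ h j; apply: h.
have /choice[x xP] := fun T => lattice_simplex_labelling i0 T.+1 (lab \o sc T).
have xT T i : (x T i <= T.+1)%N.
  by have [<- _] := xP T; rewrite (bigD1 i)//= leq_addr.
have sc0 (T : nat) : 0 < S / T.+1%:R by rewrite divr_gt0.
have /choice[v vP] : forall i, exists l, 0 <= l <= S /\ sc T (x T) i @[T --> U] --> l.
  move=> i; have [T|l lS ul] := @ultra_cvg_itv R 0 S (fun T => sc T (x T) i).
    apply/andP; split; first by rewrite mulr_ge0// ltW.
    by rewrite /sc -mulrA ler_piMr ?(ltW S0)// mulrC ler_pdivrMr// mul1r ler_nat.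
  by exists l.
have small : (S / T.+1%:R * #|I|%:R) @[T --> U] --> (0 : R).
  apply: cvg_oo_ultra.
  rewrite -[X in _ --> X](mul0r #|I|%:R); apply: cvgMr_tmp.
  rewrite -[X in _ --> X](mulr0 S); apply: cvgMl_tmp.
  exact: cvg_harmonic.
exists v; split.
- by move=> i; case: (vP i) => /andP[].
- have hv : (\sum_i sc T (x T) i) @[T --> U] --> \sum_i v i.
    apply: cvg_big => [|i _]; first exact: add_continuous.
    by case: (vP i).
  have hS : (\sum_i sc T (x T) i) @[T --> U] --> S.
    rewrite (_ : (fun T => _) = fun=> S); first exact: cvg_cst.
    apply/funext => T; rewrite -mulr_sumr -natr_sum; have [-> _] := xP T.
    by rewrite divfK.
  exact: (cvg_unique _ hv hS).
move=> i j vi.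
have big : \forall T \near U, (#|I| < x T i)%N.
  have h : (sc T (x T) i - S / T.+1%:R * #|I|%:R) @[T --> U] --> v i - 0.
    by apply: cvgB => //; case: (vP i).
  rewrite subr0 in h; apply: filterS (cvgr_gt _ h _ vi) => T /=.
  by rewrite subr_gt0 /sc ltr_pM2l// ltr_nat.
have /choice[y yP] : forall T, exists y : I -> nat, (#|I| < x T i)%N ->
    [/\ \sum_i y i = T.+1, lab (sc T y) = i &
      forall j, (x T j <= y j + #|I|)%N /\ (y j <= x T j + #|I|)%N].
  move=> T; have [h|h] := boolP (#|I| < x T i)%N; last by exists (x T).
  by have [_ /(_ i h)[y yP]] := xP T; exists y.
have yv k : sc T (y T) k @[T --> U] --> v k.
  have [_ xv] := vP k.
  apply: (@squeeze_cvgr _ U _ _ (fun T => sc T (x T) k - S / T.+1%:R * #|I|%:R)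
    (fun T => sc T (x T) k + S / T.+1%:R * #|I|%:R)).
  - apply: filterS big => T /yP[_ _ /(_ k)[h1 h2]].
    rewrite lerBlDr /sc -!mulrDr !ler_pM2l// -!natrD !ler_nat.
    by rewrite h1 h2.
  - by rewrite -[v k]subr0; apply: cvgB.
  - by rewrite -[v k]addr0; apply: cvgD.
apply: (@ler_cvg_to _ U _ _ (fun T => F i (sc T (y T))) (fun T => F j (sc T (y T)))).
- exact: (cF (fun T => sc T (y T))).
- exact: (cF (fun T => sc T (y T))).
- by apply: filterS big => T /yP[_ e _]; rewrite -{1}e; exact: labP.
Qed.

End Ultralimits.

(** * The torus and moduli of continuity *)

Lemma cvg_row (T : Type) (F : set_system T) (FF : Filter F) (R : realType) (n : nat)
    (f : T -> 'rV[R]_n) (l : 'rV[R]_n) :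
  (forall i, f k 0 i @[k --> F] --> l 0 i) -> f @ F --> l.
Proof.
move=> fl; apply/cvg_ballP => e e0.
have : \forall k \near F, forall i, ball (l 0 i) e (f k 0 i).
  by apply: filter_forall => i; move/cvg_ballP: (fl i); apply.
by apply: filterS => k h; split=> // i j; rewrite ord1; exact: h.
Qed.

Lemma cvg_maxr (T : Type) (F : set_system T) (FF : Filter F) (R : realType)
    (f g : T -> R) (a b : R) :
  f @ F --> a -> g @ F --> b -> Num.max (f k) (g k) @[k --> F] --> Num.max a b.
Proof.
move=> fa gb; rewrite maxr_absE; under eq_fun do rewrite maxr_absE.
apply: cvgMr_tmp; apply: cvgD; first exact: cvgD.
by apply: cvg_norm; apply: cvgB.
Qed.

Section TorusTopology.
Context (R : realType) (n : nat).

Lemma torus_projP (a b : 'rV[R]_n) :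
  torus_proj a = torus_proj b <-> forall i, a 0 i - b 0 i \is a Num.int.
Proof.
split=> [ab|ab]; first by apply/forallP; apply/(@eqmodP _ (@zcongr_equiv R n)).
by apply/(@eqmodP _ (@zcongr_equiv R n)); apply/forallP.
Qed.

Lemma torus_proj_continuous : continuous (@torus_proj R n).
Proof. exact: pi_continuous. Qed.

Lemma torus_proj_repr (x : torus R n) : torus_proj (repr x) = x.
Proof. exact: reprK. Qed.

Lemma torus_compact : compact [set: torus R n].
Proof.
have -> : [set: torus R n] =
    @torus_proj R n @` [set a : 'rV[R]_n | forall i, `[0, 1]%classic (a ord0 i)].
  apply/seteqP; split=> // x _; pose a := repr x.
  exists (\row_i (a 0 i - (Num.floor (a 0 i))%:~R)).
    move=> i; rewrite mxE /= in_itv /= subr_ge0 floor_le/= lerBlDr.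
    by rewrite addrC ltW// -[1]/(1%:~R) -intrD floorD1_gt.
  rewrite -[RHS]torus_proj_repr; apply/torus_projP => i; rewrite mxE.
  by rewrite addrAC subrr add0r rpredN intr_int.
apply: continuous_compact.
  by apply: continuous_subspaceT; exact: torus_proj_continuous.
exact: (@rV_compact R n (fun=> `[0, 1]%classic) (fun=> @segment_compact R 0 1)).
Qed.

End TorusTopology.

(** * Modulus of continuity in the momentum *)

Section Modulus.
Context (R : realType) (T : Type) (n : nat) (G : T -> 'rV[R]_n -> R) (M : R).
Hypothesis G_bound : forall x (p : 'rV[R]_n), `|G x p| <= M.
Hypothesis G_equicontinuous : forall e : R, 0 < e -> exists2 d : R, 0 < d &
  forall x (p q : 'rV[R]_n), (forall i, `|p 0 i - q 0 i| <= d) -> `|G x p - G x q| <= e.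

(** Increments of [p] are measured coordinatewise, as in the maximum norm. The value 0 keeps the set
    nonempty, and [modulus] nonnegative, even when no pair qualifies. *)
Definition modulus_set (t : R) : set R :=
  [set s | s = 0 \/ exists x (p q : 'rV[R]_n),
    (forall i, `|p 0 i - q 0 i| <= t) /\ s = `|G x p - G x q|].

Definition modulus (t : R) : R := sup (modulus_set t).

Lemma modulus_set_ub t : 0 <= M -> ubound (modulus_set t) (M + M).
Proof.
move=> M0 s [->|[x [p [q [_ ->]]]]]; first exact: addr_ge0.
by apply: le_trans (ler_normB _ _) _; exact: lerD.
Qed.

Lemma modulus_has_sup t : 0 <= M -> has_sup (modulus_set t).
Proof.
by move=> M0; split; [exists 0; left|exists (M + M); exact: modulus_set_ub].
Qed.

Lemma le_modulus x (p q : 'rV[R]_n) (t : R) : 0 <= M ->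
  (forall i, `|p 0 i - q 0 i| <= t) ->
  `|G x p - G x q| <= modulus t.
Proof.
move=> M0 pq; apply: (sup_upper_bound (modulus_has_sup t M0)).
by right; exists x, p, q.
Qed.

Lemma modulus_ge0 t : 0 <= M -> 0 <= modulus t.
Proof.
by move=> M0; apply: (sup_upper_bound (modulus_has_sup t M0)); left.
Qed.

Lemma modulus_le t c : 0 <= c ->
  (forall x (p q : 'rV[R]_n), (forall i, `|p 0 i - q 0 i| <= t) ->
     `|G x p - G x q| <= c) ->
  modulus t <= c.
Proof.
move=> c0 h; apply: ge_sup; first by exists 0; left.
by move=> s [->//|[x [p [q [pq ->]]]]]; exact: h.
Qed.

Lemma modulus_le_bound t : 0 <= M -> modulus t <= M + M.
Proof.
move=> M0; apply: ge_sup; first by exists 0; left.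
exact: modulus_set_ub.
Qed.

Lemma modulus_mono s t : 0 <= M -> s <= t -> modulus s <= modulus t.
Proof.
move=> M0 st; apply: modulus_le; first exact: modulus_ge0.
by move=> x p q pq; apply: le_modulus => // i; exact: le_trans (pq i) st.
Qed.

(* Convexity of the space of momenta: a segment is cut in proportion s : t. *)
Lemma modulusD s t : 0 <= M -> 0 <= s -> 0 <= t ->
  modulus (s + t) <= modulus s + modulus t.
Proof.
move=> M0 s0 t0; apply: modulus_le; first by rewrite addr_ge0// modulus_ge0.
move=> x p q pq; have [st0|st0] := eqVneq (s + t) 0.
  rewrite -[leLHS]addr0 lerD ?modulus_ge0//; apply: le_modulus => // i.
  by apply: le_trans (pq i) _; rewrite st0.
pose m := p + (s / (s + t)) *: (q - p).
have st : 0 < s + t by rewrite lt_neqAle eq_sym st0 addr_ge0.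
rewrite -(subrKA (G x m)); apply: le_trans (ler_normD _ _) _.
apply: lerD; apply: le_modulus => // i; rewrite !mxE.
  rewrite (_ : _ - _ = s / (s + t) * (p 0 i - q 0 i)); last ring.
  rewrite normrM ger0_norm ?divr_ge0// ?(ltW st)//.
  by rewrite -mulrA ler_piMr// mulrC ler_pdivrMr// mul1r.
rewrite (_ : _ - _ = t / (s + t) * (p 0 i - q 0 i)); last by field.
rewrite normrM ger0_norm ?divr_ge0// ?(ltW st)//.
by rewrite -mulrA ler_piMr// mulrC ler_pdivrMr// mul1r.
Qed.

Lemma modulus_cvg0 (F : set_system nat) (FF : Filter F) (u : nat -> R) : 0 <= M ->
  u @ F --> (0 : R) -> modulus (u k) @[k --> F] --> (0 : R).
Proof.
move=> M0 u0; apply/cvgrPdist_le => e e0.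
have [d d0 hd] := G_equicontinuous e0.
move/cvgrPdist_le: u0 => /(_ _ d0); apply: filterS => k.
rewrite !sub0r !normrN => uk; rewrite ger0_norm ?modulus_ge0//.
apply: modulus_le; first exact: ltW.
by move=> x p q pq; apply: hd => i; apply: le_trans (pq i) (le_trans (ler_norm _) uk).
Qed.

(** Subadditivity bounds the difference of two values of [modulus] by its value at the distance of
    the arguments, so continuity at 0 spreads to all nonnegative points. *)
Lemma modulus_cvg (F : set_system nat) (FF : Filter F) (u : nat -> R) (l : R) :
  0 <= M -> (forall k, 0 <= u k) -> 0 <= l ->
  u @ F --> l -> modulus (u k) @[k --> F] --> modulus l.
Proof.
move=> M0 u0 l0 ul.
have h : modulus `|l - u k| @[k --> F] --> (0 : R).
  apply: modulus_cvg0 => //; rewrite -[0](normr0 R) -(subrr l).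
  by apply: cvg_norm; apply: cvgB => //; exact: cvg_cst.
apply/cvgrPdist_le => e e0; move/cvgrPdist_le: h => /(_ _ e0); apply: filterS => k.
rewrite sub0r normrN ger0_norm ?modulus_ge0//; apply: le_trans.
have key (a b : R) : 0 <= a -> 0 <= b -> modulus a <= modulus b + modulus `|a - b|.
  move=> a0 b0; apply: le_trans (modulusD M0 b0 (normr_ge0 _)).
  by apply: modulus_mono => //; rewrite -lerBlDl; exact: ler_norm.
rewrite ler_norml; have := key _ _ l0 (u0 k); have := key _ _ (u0 k) l0.
by rewrite (distrC _ l); lra.
Qed.

End Modulus.

(** * The scheme *)

Section NumericalHamiltonian.
Context (R : realType) (n : nat) (w : R -> R).
Hypothesis w_ge0 : forall t, 0 <= w t.
Hypothesis w0 : w 0 = 0.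
Hypothesis w_mono : forall s t : R, s <= t -> w s <= w t.
Hypothesis wD : forall s t : R, 0 <= s -> 0 <= t -> w (s + t) <= w s + w t.

(* Odd extension of the modulus [w]. When a test function touches the grid
   function from above, [a i - b i] bounds twice the distance of [(a i + b i) / 2]
   to the gradient, so that this term pays for evaluating [g] at the mean of the
   two quotients; when it touches from below, the signs are reversed. *)
Definition numvisc (s : R) : R := w (Num.max s 0) - w (Num.max (- s) 0).

(* [a] and [b] stand for the backward and forward difference quotients. *)
Definition numham (g : 'rV[R]_n -> R) (a b : 'I_n -> R) : R :=
  g (\row_i ((a i + b i) / 2)) + \sum_i numvisc (a i - b i).

Lemma numviscN s : numvisc (- s) = - numvisc s.
Proof. by rewrite /numvisc opprK opprB. Qed.

Lemma modulus_sum (t : 'I_n -> R) : (forall i, 0 <= t i) ->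
  w (\sum_i t i) <= \sum_i w (t i).
Proof.
move=> t0; suff [] : 0 <= \sum_i t i /\ w (\sum_i t i) <= \sum_i w (t i) by [].
elim/big_ind2: _ => [|x1 x2 y1 y2 [x10 hx] [y10 hy]|i _].
- by rewrite w0.
- split; first exact: addr_ge0.
  by apply: le_trans (wD x10 y10) _; exact: lerD.
- by [].
Qed.

(** Consistency under the one-sided bounds available where a test function touches from above. The
    mean [q] is within [o] plus the sum of the [t i] of [p]; subadditivity charges this to [w o] and
    to the terms [w (t i)] of the viscosity, whose negative parts cost at most [w (2 * o)] each. *)
Lemma numham_ge (g : 'rV[R]_n -> R) (a b : 'I_n -> R) (p : 'rV[R]_n) (o : R) :
  (forall (q : 'rV[R]_n) (t : R), (forall i, `|p 0 i - q 0 i| <= t) ->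
     `|g p - g q| <= w t) ->
  0 <= o -> (forall i, p 0 i - o <= a i) -> (forall i, b i <= p 0 i + o) ->
  g p - (w o + n%:R * w (2 * o)) <= numham g a b.
Proof.
move=> gw o0 ap bp; rewrite /numham; set q := \row_i _.
pose t i := Num.max (a i - b i) 0.
have t0 i : 0 <= t i by rewrite le_max lexx orbT.
have tab i : a i - b i <= t i by rewrite le_max lexx.
have : `|g p - g q| <= \sum_i w (t i) + w o.
  apply: (@le_trans _ _ (w (\sum_i t i + o))).
    apply: gw => i; rewrite mxE; have h : t i <= \sum_i t i.
      by rewrite (bigD1 i)//= lerDl sumr_ge0.
    have h1 := ap i; have h2 := bp i; have h3 := tab i; have h4 := t0 i.
    by rewrite ler_norml; apply/andP; split; lra.
  apply: le_trans (wD _ o0) _; first exact: sumr_ge0.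
  by rewrite lerD2r; exact: modulus_sum.
have : \sum_i w (t i) - n%:R * w (2 * o) <= \sum_i numvisc (a i - b i).
  have -> : n%:R * w (2 * o) = \sum_(i < n) w (2 * o).
    by rewrite sumr_const card_ord mulr_natl.
  rewrite -sumrB; apply: ler_sum => i _; rewrite /numvisc lerD2l lerN2.
  apply: w_mono; rewrite ge_max; apply/andP; split; last by lra.
  by have := ap i; have := bp i; lra.
by rewrite ler_norml; lra.
Qed.

(** The mirror image: [numham_ge] for [- g] with the two quotients exchanged, [numvisc] being
    odd. *)
Lemma numham_le (g : 'rV[R]_n -> R) (a b : 'I_n -> R) (p : 'rV[R]_n) (o : R) :
  (forall (q : 'rV[R]_n) (t : R), (forall i, `|p 0 i - q 0 i| <= t) ->
     `|g p - g q| <= w t) ->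
  0 <= o -> (forall i, a i <= p 0 i + o) -> (forall i, p 0 i - o <= b i) ->
  numham g a b <= g p + (w o + n%:R * w (2 * o)).
Proof.
move=> gw o0 ap bp.
have gw' (q : 'rV[R]_n) (t : R) : (forall i, `|p 0 i - q 0 i| <= t) ->
    `|- g p - - g q| <= w t.
  by move=> /gw; rewrite -opprD normrN.
have := @numham_ge (fun q => - g q) b a p o gw' o0 bp ap.
rewrite /numham (_ : \row_i ((b i + a i) / 2) = \row_i ((a i + b i) / 2)).
  rewrite (_ : \sum_i numvisc (b i - a i) = - \sum_i numvisc (a i - b i)); first by lra.
  by rewrite -sumrN; apply: eq_bigr => i _; rewrite -numviscN opprB.
by apply/rowP => i; rewrite !mxE addrC.
Qed.

Lemma numham_lower_bound (g : 'rV[R]_n -> R) (a b : 'I_n -> R) (M W : R) :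
  (forall p : 'rV[R]_n, `|g p| <= M) -> (forall t, w t <= W) ->
  - (M + n%:R * W) <= numham g a b.
Proof.
move=> gM wW; rewrite opprD lerD//.
  by have := gM (\row_i ((a i + b i) / 2)); rewrite ler_norml => /andP[].
have -> : - (n%:R * W) = \sum_(i < n) - W.
  by rewrite sumr_const card_ord mulNrn mulr_natl.
apply: ler_sum => i _; rewrite /numvisc.
by have := wW (Num.max (- (a i - b i)) 0); have := w_ge0 (Num.max (a i - b i) 0); lra.
Qed.

End NumericalHamiltonian.

(** * Functions on the periodic lattice *)

Section Lattice.
Context (R : realType) (n : nat).
Implicit Types (z y : 'I_n -> int).

Definition lattice_step z (i : 'I_n) (e : int) : 'I_n -> int :=
  fun j => if j == i then z j + e else z j.

Lemma lattice_stepK z i e : lattice_step (lattice_step z i e) i (- e) = z.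
Proof.
by apply/funext => j; rewrite /lattice_step; case: eqP => // _; rewrite addrK.
Qed.

Lemma lattice_lipschitz (V : ('I_n -> int) -> R) (d : R) : 0 <= d ->
  (forall z i, `|V (lattice_step z i 1) - V z| <= d) ->
  forall z y, `|V z - V y| <= d * (\sum_i `|z i - y i|%N)%:R.
Proof.
move=> d0 Vd z y; have [k] := ubnP (\sum_i `|z i - y i|%N).
elim: k z => // k IH z; rewrite ltnS => zk.
have [/forallP zy|] := boolP [forall i, z i == y i].
  have -> : z = y by apply/funext => i; apply/eqP.
  by rewrite subrr normr0 mulr_ge0.
rewrite negb_forall => /existsP[i zyi].
pose e : int := if z i < y i then 1 else -1.
have stepd : `|V z - V (lattice_step z i e)| <= d.
  rewrite /e; case: ifP => _; first by rewrite distrC.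
  by rewrite -{1}(lattice_stepK z i (-1)) opprK.
have zs : (\sum_j `|z j - y j|)%N = (\sum_j `|lattice_step z i e j - y j|).+1%N.
  rewrite (bigD1 i)//= [in RHS](bigD1 i)//= /lattice_step eqxx -addSn; congr (_ + _)%N.
    by rewrite /e; case: ltP => h; move/eqP: zyi => zyi; lia.
  by apply: eq_bigr => j /negbTE ->.
rewrite zs mulrSr mulrDr mulr1 -(subrKA (V (lattice_step z i e))) addrC.
by apply: le_trans (ler_normD _ _) _; rewrite lerD// IH// -zs.
Qed.

End Lattice.

Lemma absz_sub_le (a b m : nat) :
  (a <= m)%N -> (b <= m)%N -> (`|a%:Z - b%:Z| <= m)%N.
Proof. lia. Qed.

Section Scheme.
Context (R : realType) (n : nat) (K : torus R n -> R -> 'rV[R]_n -> R).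
Context (w : R -> R) (A L : R) (N : nat).
Implicit Types (V : ('I_n -> int) -> R) (z y : 'I_n -> int).

Definition lattice_point z : 'rV[R]_n := \row_i ((z i)%:~R / N.+1%:R).

Definition bwd V z i : R := N.+1%:R * (V z - V (lattice_step z i (-1))).

Definition fwd V z i : R := N.+1%:R * (V (lattice_step z i 1) - V z).

(* The penalty plays the role of the coercivity of the Hamiltonian: it forces
   the difference quotients of a discrete solution below [L + 1]. *)
Definition slope_penalty V z : R :=
  A * \sum_i (Num.max (bwd V z i - L) 0 + Num.max (- fwd V z i - L) 0).

Definition scheme V z : R :=
  numham w (K (torus_proj (lattice_point z)) (V z)) (bwd V z) (fwd V z)
  + slope_penalty V z.

(** Grid functions on the torus are kept as periodic functions of integer vectors, so that steps
    need no reduction; [lattice_class] provides the finite index set for the variational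
    inequality. *)
Definition lattice_periodic V :=
  forall z y, (forall i, (N.+1%:Z %| z i - y i)%Z) -> V z = V y.

Lemma lattice_point_congr z y : (forall i, (N.+1%:Z %| z i - y i)%Z) ->
  torus_proj (lattice_point z) = torus_proj (lattice_point y).
Proof.
move=> zy; apply/torus_projP => i; rewrite !mxE.
have /dvdzP[q e] := zy i.
rewrite -mulrBl -intrB e intrM (_ : _ / _ = q%:~R) ?intr_int//.
by rewrite -pmulrn mulfK.
Qed.

Lemma lattice_step_congr z y i e : (forall i, (N.+1%:Z %| z i - y i)%Z) ->
  forall j, (N.+1%:Z %| lattice_step z i e j - lattice_step y i e j)%Z.
Proof.
move=> zy j; rewrite /lattice_step; case: ifP => // _.
by rewrite opprD addrACA subrr addr0.
Qed.

Lemma scheme_congr V : lattice_periodic V ->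
  forall z y, (forall i, (N.+1%:Z %| z i - y i)%Z) -> scheme V z = scheme V y.
Proof.
move=> perV z y zy.
have eb : bwd V z = bwd V y.
  apply/funext => i; rewrite /bwd (perV _ _ zy).
  by rewrite (perV _ _ (lattice_step_congr i (-1) zy)).
have ef : fwd V z = fwd V y.
  apply/funext => i; rewrite /fwd (perV _ _ zy).
  by rewrite (perV _ _ (lattice_step_congr i 1 zy)).
rewrite /scheme /slope_penalty eb ef (perV _ _ zy).
by rewrite (lattice_point_congr zy).
Qed.

Definition lattice_class z : {ffun 'I_n -> 'I_N.+1} :=
  [ffun i => inord `|(z i %% N.+1%:Z)%Z|%N].

Definition class_rep (g : {ffun 'I_n -> 'I_N.+1}) : 'I_n -> int :=
  fun i => (g i : nat)%:Z.

Lemma lattice_class_congr z y : (forall i, (N.+1%:Z %| z i - y i)%Z) ->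
  lattice_class z = lattice_class y.
Proof.
move=> zy; apply/ffunP => i; rewrite !ffunE; do 2!f_equal.
by apply/eqP; rewrite eqz_mod_dvd.
Qed.

Lemma class_repK z i : (N.+1%:Z %| class_rep (lattice_class z) i - z i)%Z.
Proof.
rewrite /class_rep ffunE -eqz_mod_dvd inordK.
  by rewrite gez0_abs ?modz_ge0// modz_mod.
by rewrite -ltz_nat gez0_abs ?modz_ge0// ltz_pmod.
Qed.

Lemma lattice_classK g : lattice_class (class_rep g) = g.
Proof.
apply/ffunP => i; apply/val_inj; rewrite /class_rep ffunE /= modz_nat absz_nat.
by rewrite modn_small// inordK.
Qed.

Section DiscreteSolution.
Context (U : set_system nat) (UU : UltraFilter U) (Uoo : \oo `<=` U).
Context (M W c0 B : R).
Hypothesis w_ge0 : forall t, 0 <= w t.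
Hypothesis w_le : forall t, w t <= W.
Hypothesis w0 : w 0 = 0.
Hypothesis w_mono : forall s t : R, s <= t -> w s <= w t.
Hypothesis wD : forall s t : R, 0 <= s -> 0 <= t -> w (s + t) <= w s + w t.
Hypothesis w_cvg : forall (u : nat -> R) (l : R), (forall k, 0 <= u k) -> 0 <= l ->
  u @ U --> l -> w (u k) @[k --> U] --> w l.
Hypothesis K_cvg : forall x (r : nat -> R) (l : R) (p : nat -> 'rV[R]_n) (q : 'rV[R]_n),
  r @ U --> l -> p @ U --> q -> K x (r k) (p k) @[k --> U] --> K x l q.
Hypothesis K_mod : forall x r (p q : 'rV[R]_n) (t : R),
  (forall i, `|p 0 i - q 0 i| <= t) -> `|K x r p - K x r q| <= w t.
Hypothesis K_bound : forall x r (p : 'rV[R]_n), `|K x r p| <= M.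
Hypothesis K0_le : forall x r, K x r 0 <= c0.
Hypothesis L0 : 0 <= L.
Hypothesis A0 : 0 < A.
Hypothesis A_ge : c0 + (M + n%:R * W) <= A.
Hypothesis B_gt : n%:R * (L + 1) < B.

Lemma scheme_cvg (u : nat -> ('I_n -> int) -> R) V :
  (forall z, u k z @[k --> U] --> V z) ->
  forall z, scheme (u k) z @[k --> U] --> scheme V z.
Proof.
move=> uV z.
have bV i : bwd (u k) z i @[k --> U] --> bwd V z i.
  by apply: cvgMl_tmp; apply: cvgB.
have fV i : fwd (u k) z i @[k --> U] --> fwd V z i.
  by apply: cvgMl_tmp; apply: cvgB.
have pV (f : nat -> R) (l : R) : f @ U --> l ->
    Num.max (f k) 0 @[k --> U] --> Num.max l 0.
  by move=> fl; apply: cvg_maxr => //; exact: cvg_cst.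
apply: cvgD; first apply: cvgD.
- apply: K_cvg => //; apply: cvg_row => i; rewrite mxE.
  under eq_fun do rewrite mxE.
  by apply: cvgMr_tmp; apply: cvgD.
- apply: cvg_big => [|i _]; first exact: add_continuous.
  by apply: cvgB; (apply: w_cvg; [by move=> k; rewrite le_max lexx orbT
    |by rewrite le_max lexx orbT|apply: pV]); [|apply: cvgN]; apply: cvgB.
- apply: cvgMl_tmp; apply: cvg_big => [|i _]; first exact: add_continuous.
  by apply: cvgD; apply: pV; apply: cvgB; (try exact: cvg_cst) => //; apply: cvgN.
Qed.

(** At a minimum the backward quotients are nonpositive and the forward ones nonnegative: the
    penalty vanishes as [L] is nonnegative, and [numham_le] applies at momentum 0 with no error. *)
Lemma scheme_min V z : (forall y, V z <= V y) -> scheme V z <= c0.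
Proof.
move=> zmin.
have b0 i : bwd V z i <= 0.
  by rewrite /bwd pmulr_rle0// subr_le0.
have f0 i : 0 <= fwd V z i.
  by rewrite /fwd pmulr_rge0// subr_ge0.
have -> : scheme V z =
    numham w (K (torus_proj (lattice_point z)) (V z)) (bwd V z) (fwd V z).
  rewrite /scheme /slope_penalty big1 ?mulr0 ?addr0// => i _.
  by rewrite !max_r ?addr0// subr_le0; apply: le_trans L0; rewrite ?oppr_le0.
apply: le_trans (numham_le w0 w_mono wD (p := 0) (o := 0) _ _ _ _) _ => //.
- by move=> q t; exact: K_mod.
- by move=> i; rewrite mxE addr0.
- by move=> i; rewrite mxE subrr.
- by rewrite !mulr0 w0 mulr0 !addr0.
Qed.

Lemma slope_penalty_ge V z i :
  A * (bwd V z i - L) <= slope_penalty V z /\ A * (- fwd V z i - L) <= slope_penalty V z.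
Proof.
have pos (x : R) : 0 <= Num.max x 0 by rewrite le_max lexx orbT.
have xm (x : R) : x <= Num.max x 0 by rewrite le_max lexx.
rewrite /slope_penalty !ler_pM2l// (bigD1 i)//=.
set s := \sum_(j | j != i) _; have s0 : 0 <= s by apply: sumr_ge0 => j _; exact: addr_ge0.
have := pos (bwd V z i - L); have := pos (- fwd V z i - L).
have := xm (bwd V z i - L); have := xm (- fwd V z i - L).
move: (bwd _ _ _) (fwd _ _ _) => x y; split; lra.
Qed.

Lemma scheme_ge V z : slope_penalty V z - (M + n%:R * W) <= scheme V z.
Proof.
by rewrite addrC /scheme lerD2r; exact: numham_lower_bound.
Qed.

(** The rest of the scheme is at least [- (M + n%:R * W)], so the penalty is at most [A] and each
    penalized slope exceeds [L] by at most 1. *)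
Lemma slope_bound V z i : scheme V z <= c0 ->
  bwd V z i <= L + 1 /\ - fwd V z i <= L + 1.
Proof.
move=> Vc; have [h1 h2] := slope_penalty_ge V z i; have h3 := scheme_ge V z.
by split; rewrite -lerBlDl -(ler_pM2l A0) mulr1; have := A_ge; lra.
Qed.

(* The mean of [V] is prescribed to be [B]. Where [V] is positive the scheme takes
   its least value, which is at most its value at a minimum of [V], hence at most
   [c0]; this bounds the slopes, and where [V] vanishes they are nonpositive. The
   oscillation of [V] is thus below [B] and [V] is positive everywhere. *)
Lemma discrete_solution : exists V c,
  [/\ lattice_periodic V, forall z, 0 <= V z <= B + n%:R * (L + 1),
    forall z i, `|V (lattice_step z i 1) - V z| <= (L + 1) / N.+1%:R,
    forall z, scheme V z = c & - (M + n%:R * W) <= c <= c0].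
Proof.
pose I := {ffun 'I_n -> 'I_N.+1}; pose g0 : I := [ffun=> ord0].
pose ext (v : I -> R) : ('I_n -> int) -> R := fun z => v (lattice_class z).
have ext_per v : lattice_periodic (ext v).
  by move=> z y zy; rewrite /ext (lattice_class_congr zy).
have I0 : 0 < #|I|%:R :> R by rewrite ltr0n; apply/card_gt0P; exists g0.
have l0 : 0 <= L + 1 by rewrite addr_ge0.
have B0 : 0 < B by apply: le_lt_trans B_gt; rewrite mulr_ge0.
have [||v [v0 sv vF]] := @variational_inequality U UU Uoo R I g0
    (fun g v => scheme (ext v) (class_rep g)) (B * #|I|%:R).
- exact: mulr_gt0.
- move=> u v uv g; apply: (scheme_cvg (u := fun k => ext (u k))) => z.
  exact: uv.
pose V := ext v; have perV : lattice_periodic V := ext_per v.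
pose gm := [arg min_(g < g0) v g]%O.
have gmP g : v gm <= v g by rewrite /gm; case: arg_minP => // i _; apply.
have Vg g : V (class_rep g) = v g by rewrite /V /ext lattice_classK.
have vle g : 0 < v g -> scheme V (class_rep g) <= c0.
  move=> vg; apply: le_trans (vF g gm vg) _; apply: scheme_min => z.
  by rewrite -/V Vg; exact: gmP.
have N0 : 0 < N.+1%:R :> R by [].
have bV z i : bwd V z i <= L + 1 /\ - fwd V z i <= L + 1.
  have [vz|vz] := ltP 0 (V z).
    apply: slope_bound; rewrite -(scheme_congr perV (class_repK z)).
    exact: vle.
  have Vz : V z = 0 by apply/eqP; rewrite eq_le vz; exact: v0.
  rewrite /bwd /fwd Vz !subr0 sub0r mulrN; split.
    by apply: le_trans l0; rewrite oppr_le0 mulr_ge0//; exact: v0.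
  by apply: le_trans l0; rewrite oppr_le0 mulr_ge0//; exact: v0.
(* The upper bound on a forward quotient is the one on the backward quotient at the next point. *)
have lipV z i : `|V (lattice_step z i 1) - V z| <= (L + 1) / N.+1%:R.
  rewrite ler_norml; apply/andP; split.
    rewrite lerNl ler_pdivlMr// mulrC; have [_] := bV z i.
    by rewrite /fwd -mulrN.
  rewrite ler_pdivlMr// mulrC; have [+ _] := bV (lattice_step z i 1) i.
  by rewrite /bwd lattice_stepK.
(* Two representatives in the cube are joined by at most [n * N.+1] steps, each changing [V] by at
   most [(L + 1) / N.+1]. *)
have osc g h : v g - v h <= n%:R * (L + 1).
  rewrite -!Vg; apply: le_trans (ler_norm _) _.
  have d0 : 0 <= (L + 1) / N.+1%:R by rewrite divr_ge0.
  apply: le_trans (lattice_lipschitz d0 lipV _ _) _.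
  rewrite mulrAC ler_pdivrMr// mulrC mulrAC ler_wpM2r//.
  rewrite -natrM ler_nat -[n in (n * _)%N]card_ord -sum_nat_const.
  apply: leq_sum => i _; rewrite /class_rep.
  exact: absz_sub_le (ltnW (ltn_ord (g i))) (ltnW (ltn_ord (h i))).
have sB : \sum_(g : I) B = B * #|I|%:R by rewrite sumr_const mulr_natr.
have [g1 g1B] : exists g, B <= v g.
  apply: contrapT => /forallNP vB.
  have : \sum_g v g < \sum_(g : I) B.
    apply: ltr_sum; first by apply/hasP; exists g0; rewrite ?mem_index_enum.
    by move=> g _; rewrite ltNge; apply/negP; exact: vB.
  by rewrite sv sB ltxx.
have [g2 g2B] : exists g, v g <= B.
  apply: contrapT => /forallNP vB.
  have : \sum_(g : I) B < \sum_g v g.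
    apply: ltr_sum; first by apply/hasP; exists g0; rewrite ?mem_index_enum.
    by move=> g _; rewrite ltNge; apply/negP; exact: vB.
  by rewrite sv sB ltxx.
have vpos g : 0 < v g by have := osc g1 g; have := B_gt; lra.
have sV z : scheme V z = scheme V (class_rep gm).
  rewrite -(scheme_congr perV (class_repK z)); apply/eqP; rewrite eq_le.
  by rewrite !vF.
exists V, (scheme V (class_rep gm)); split=> //.
  by move=> z; rewrite v0 /=; have := osc (lattice_class z) g2; rewrite /V /ext; lra.
rewrite vle// andbT; apply: le_trans (scheme_ge _ _).
rewrite -[leLHS]add0r lerD2r; apply: mulr_ge0; first exact: ltW.
apply: sumr_ge0 => i _.
by rewrite addr_ge0// le_max lexx orbT.
Qed.

End DiscreteSolution.
End Scheme.

(** * Passage to the limit *)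

Lemma cvg_coord (T : Type) (F : set_system T) (FF : Filter F) (R : realType) (n : nat)
    (f : T -> 'rV[R]_n) (l : 'rV[R]_n) i :
  f @ F --> l -> f k 0 i @[k --> F] --> l 0 i.
Proof.
move=> fl; apply: (@cvg_comp _ _ _ f (fun M : 'rV[R]_n => M 0 i) _ _ _ fl).
exact: coord_continuous.
Qed.

Lemma directional_MVT (R : realType) (n : nat) (f : 'rV[R]_n -> R)
    (x e : 'rV[R]_n) (h : R) : (forall a, differentiable f a) ->
  exists2 t : R, 0 <= t <= 1 & f (x + h *: e) - f x = h * 'D_e f (x + (t * h) *: e).
Proof.
move=> df; pose phi (t : R) : R := f (x + t *: (h *: e)).
have line (t s : R) : phi (s *: (1 : R) + t) = f (s *: (h *: e) + (x + t *: (h *: e))).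
  rewrite /phi; congr f; rewrite /GRing.scale/= mulr1 -!/(GRing.scale _ _).
  by rewrite scalerDl addrCA.
have dphi (t : R) : is_derive t (1 : R) phi ('D_(h *: e) f (x + t *: (h *: e))).
  have E : (fun s : R => s^-1 *: ((phi \o shift t) (s *: (1 : R)) - phi t)) =
      (fun s : R => s^-1 *: ((f \o shift (x + t *: (h *: e))) (s *: (h *: e)) -
        f (x + t *: (h *: e)))).
    by apply/funext => s /=; rewrite line.
  have dd := @diff_derivable _ _ _ f (x + t *: (h *: e)) (h *: e) (df _).
  by apply: DeriveDef; rewrite /derivable /derive E.
have [t t01] := @MVT_segment R phi _ 0 1 ler01 (fun t _ => dphi t)
  (derivable_within_continuous (fun t _ => @ex_derive _ _ _ _ _ _ _ (dphi t))).
rewrite /phi scale1r scale0r addr0 subr0 mulr1 => ->.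
exists t; first by move: t01; rewrite in_itv.
by rewrite scalerA deriveE// linearZ/= -deriveE.
Qed.

(** The base point moves along with the step; the mean value theorem turns the quotient into a
    derivative at a nearby point, and continuity of the derivative at [a] concludes. *)
Lemma cvg_difference_quotient (R : realType) (n : nat) (F : set_system nat)
    (FF : Filter F) (f : 'rV[R]_n -> R) (a e : 'rV[R]_n)
    (x : nat -> 'rV[R]_n) (h : nat -> R) :
  (forall a, differentiable f a) -> {for a, continuous ('D_e f)} ->
  x @ F --> a -> h @ F --> (0 : R) -> (forall k, h k != 0) ->
  (f (x k + h k *: e) - f (x k)) / h k @[k --> F] --> 'D_e f a.
Proof.
move=> df ce xa h0 hn0.
have /choice[t tP] : forall k, exists t : R, 0 <= t <= 1 /\
    f (x k + h k *: e) - f (x k) = h k * 'D_e f (x k + (t * h k) *: e).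
  by move=> k; have [t t01 ft] := directional_MVT (x k) e (h k) df; exists t.
rewrite (_ : (fun k => _) = fun k => 'D_e f (x k + (t k * h k) *: e)); last first.
  by apply/funext => k; have [_ ->] := tP k; rewrite mulrC mulKf.
suff ya : x k + (t k * h k) *: e @[k --> F] --> a by exact: cvg_comp ya ce.
rewrite -[a]addr0 -(scale0r e); apply: cvgD => //; apply: cvgZr_tmp.
apply/cvgrPdist_le => eps e0; move/cvgrPdist_le: h0 => /(_ _ e0); apply: filterS => k.
rewrite !sub0r !normrN normrM; have [/andP[t0 t1] _] := tP k.
by apply: le_trans; rewrite ger0_norm// ler_piMl.
Qed.

Lemma cvg_harmonic_ultra (R : realType) (U : set_system nat) :
  UltraFilter U -> \oo `<=` U -> (N.+1%:R^-1 : R) @[N --> U] --> (0 : R).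
Proof. by move=> UU Uoo; apply: (cvg_oo_ultra Uoo); exact: cvg_harmonic. Qed.

(** * Limits of equi-Lipschitz grid functions *)

Section LatticeLimit.
Context (R : realType) (n : nat).
Context (U : set_system nat) (UU : UltraFilter U) (Uoo : \oo `<=` U).

Definition lattice_floor (N : nat) (a : 'rV[R]_n) : 'I_n -> int :=
  fun i => Num.floor (N.+1%:R * a 0 i).

Lemma lattice_floor_point N z : lattice_floor N (lattice_point R N z) = z.
Proof.
apply/funext => i; rewrite /lattice_floor mxE mulrC divfK//.
by rewrite intrKfloor.
Qed.

Lemma lattice_point_floor_dist N a i :
  `|lattice_point R N (lattice_floor N a) 0 i - a 0 i| <= N.+1%:R^-1.
Proof.
rewrite mxE /lattice_floor; set x := N.+1%:R * _.
have -> : a 0 i = x / N.+1%:R by rewrite /x mulrC mulKf.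
rewrite -mulrBl normrM [`|_^-1|]ger0_norm// ler_piMl//.
have := floor_le x; have := lt_succ_floor x; rewrite intrD => h1 h2.
by rewrite ler_norml; apply/andP; split; lra.
Qed.

Lemma cvg_lattice_point_floor a :
  lattice_point R N (lattice_floor N a) @[N --> U] --> a.
Proof.
apply: cvg_row => i; apply/cvgrPdist_le => e e0.
have := @cvg_harmonic_ultra R U UU Uoo.
move/cvgrPdist_le => /(_ _ e0); apply: filterS => N.
rewrite sub0r normrN ger0_norm// distrC; apply: le_trans.
exact: lattice_point_floor_dist.
Qed.

Lemma lattice_floor_dist N a b i :
  `|lattice_floor N a i - lattice_floor N b i|%N%:R <=
  N.+1%:R * `|a 0 i - b 0 i| + 1 :> R.
Proof.
rewrite /lattice_floor natr_absz intr_norm intrB.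
set x := N.+1%:R * a 0 i; set y := N.+1%:R * b 0 i.
have -> : N.+1%:R * `|a 0 i - b 0 i| = `|x - y|.
  by rewrite -mulrBr normrM [`|_.+1%:R|]ger0_norm.
have := floor_le x; have := lt_succ_floor x; have := floor_le y; have := lt_succ_floor y.
rewrite !intrD; have := ler_norm (x - y); have := ler_norm (y - x).
rewrite [`|y - x|]distrC => *.
by rewrite ler_norml; apply/andP; split; lra.
Qed.

Context (V : nat -> ('I_n -> int) -> R) (C l : R).
Hypothesis V_bound : forall N z, 0 <= V N z <= C.
Hypothesis l_ge0 : 0 <= l.
Hypothesis V_lip : forall N z i, `|V N (lattice_step z i 1) - V N z| <= l / N.+1%:R.
Hypothesis V_per : forall N, lattice_periodic N (V N).

Lemma lattice_floor_lipschitz N a b :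
  `|V N (lattice_floor N a) - V N (lattice_floor N b)| <=
  l * \sum_i (`|a 0 i - b 0 i| + N.+1%:R^-1).
Proof.
have d0 : 0 <= l / N.+1%:R by rewrite divr_ge0.
apply: le_trans (lattice_lipschitz d0 (V_lip N) _ _) _.
rewrite -mulrA ler_wpM2l// ler_pdivrMl// mulr_sumr natr_sum; apply: ler_sum => i _.
by rewrite mulrDr divff//; exact: lattice_floor_dist.
Qed.

(** The value at [a] is the ultralimit of the values at the lattice points rounding [a] down. The
    common Lipschitz bound, with a rounding error of order the mesh, shows that any lattice points
    converging to [a] give the same limit. *)
Lemma lattice_limit : exists v : 'rV[R]_n -> R,
  [/\ forall z a, lattice_point R N (z N) @[N --> U] --> a ->
        V N (z N) @[N --> U] --> v a,
      forall a, 0 <= v a <= C,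
      forall a b : 'rV[R]_n, `|v a - v b| <= l * \sum_i `|a 0 i - b 0 i| &
      forall a b : 'rV[R]_n, (forall i, a 0 i - b 0 i \is a Num.int) -> v a = v b].
Proof.
have /choice[v vP] : forall a, exists s, 0 <= s <= C /\
    V N (lattice_floor N a) @[N --> U] --> s.
  move=> a; have [s s0 hs] :=
    ultra_cvg_itv UU (u := fun N => V N (lattice_floor N a)) (fun N => V_bound N _).
  by exists s.
have hU := @cvg_harmonic_ultra R U UU Uoo.
exists v; split.
- move=> z a za; have [_ va] := vP a.
  apply/cvgrPdist_le => e e0.
  have e20 : 0 < e / 2 by rewrite divr_gt0.
  have h1 : (l * \sum_i (`|lattice_point R N (z N) 0 i - a 0 i| + N.+1%:R^-1))
      @[N --> U] --> (0 : R).
    rewrite -[X in _ --> X](mulr0 l); apply: cvgMl_tmp.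
    rewrite -[X in _ --> X](@big1_eq _ 0 +%R 'I_n (index_enum _) xpredT).
    apply: cvg_big => [|i _]; first exact: add_continuous.
    rewrite -[X in _ --> X]addr0; apply: cvgD => //.
    rewrite -[X in _ --> X](normr0 R) -(subrr (a 0 i)).
    apply: cvg_norm; apply: cvgB; last exact: cvg_cst.
    exact: cvg_coord.
  move/cvgrPdist_le: va => /(_ _ e20) va.
  move/cvgrPdist_le: h1 => /(_ _ e20) h1.
  apply: filterS2 va h1 => N; rewrite sub0r normrN => va.
  have := lattice_floor_lipschitz N (lattice_point R N (z N)) a.
  rewrite lattice_floor_point => h /(le_trans (ler_norm _)) /(le_trans h) h'.
  rewrite -(subrKA (V N (lattice_floor N a))).
  apply: le_trans (ler_normD _ _) _; rewrite [e](splitr e) lerD//.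
  by rewrite distrC.
- by move=> a; case: (vP a).
- move=> a b; have [_ va] := vP a; have [_ vb] := vP b.
  have h1 : (l * \sum_i (`|a 0 i - b 0 i| + N.+1%:R^-1))
      @[N --> U] --> l * \sum_i (`|a 0 i - b 0 i| + 0).
    apply: cvgMl_tmp; apply: cvg_big => [|i _]; first exact: add_continuous.
    by apply: cvgD => //; exact: cvg_cst.
  have -> : \sum_i `|a 0 i - b 0 i| = \sum_i (`|a 0 i - b 0 i| + 0).
    by apply: eq_bigr => i _; rewrite addr0.
  apply: ler_cvg_to (cvg_norm (cvgB va vb)) h1 _.
  by apply: nearW => N; exact: lattice_floor_lipschitz.
- move=> a b ab; have [_ va] := vP a; have [_ vb] := vP b.
  suff ab' N : V N (lattice_floor N a) = V N (lattice_floor N b).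
    by move: va; under eq_fun do rewrite ab'; move=> va; exact: (cvg_unique _ va vb).
  apply: V_per => i; rewrite /lattice_floor.
  have /intrP[k abk] := ab i.
  have -> : N.+1%:R * a 0 i = N.+1%:R * b 0 i + (N.+1%:Z * k)%:~R.
    by rewrite intrM -pmulrn -abk; ring.
  by rewrite floorDrz ?intr_int// intrKfloor addrC addKr dvdz_mulr.
Qed.

End LatticeLimit.

Lemma lattice_point_step (R : realType) (n N : nat) (z : 'I_n -> int) i (e : int) :
  lattice_point R N (lattice_step z i e) =
  lattice_point R N z + (e%:~R / N.+1%:R) *: delta_mx 0 i.
Proof.
apply/rowP => j; rewrite !mxE eqxx /lattice_step; case: eqP => _ /=.
  by rewrite mulr1 intrD mulrDl.
by rewrite mulr0 addr0.
Qed.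

(** * Contact points with a test function *)

Section TestPoint.
Context (R : realType) (n : nat).
Context (U : set_system nat) (UU : UltraFilter U) (Uoo : \oo `<=` U).
Context (V : nat -> ('I_n -> int) -> R) (v : 'rV[R]_n -> R) (C : R).

(** The lattice form of the stability argument for viscosity solutions: the squared distance makes
    the maximum at [a] strict, near-maximizers over lattice points converge to [a], and comparison
    with their neighbours bounds the quotients from one side. *)
Lemma test_point (f : 'rV[R]_n -> R) (a : 'rV[R]_n) :
  (forall N z, `|V N z| <= C) ->
  (forall z b, lattice_point R N (z N) @[N --> U] --> b ->
     V N (z N) @[N --> U] --> v b) ->
  (forall b, differentiable f b) -> continuous (grad f) ->
  (\forall b \near a, v b - f b <= v a - f a) ->
  exists (z : nat -> 'I_n -> int) (o : nat -> R),
    [/\ o @ U --> (0 : R), forall N, 0 <= o N,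
        lattice_point R N (z N) @[N --> U] --> a &
        \forall N \near U, forall i,
          grad f a 0 i - o N <= bwd N (V N) (z N) i /\
          fwd N (V N) (z N) i <= grad f a 0 i + o N].
Proof.
move=> VC Vv df cf maxa.
have cont_f : continuous f by move=> b; apply: differentiable_continuous.
pose box (r : R) := [set b : 'rV[R]_n | forall i, `|b 0 i - a 0 i| <= r].
have [r r0 rP] : exists2 r : R, 0 < r & forall b, box r b ->
    v b - f b <= v a - f a /\ `|f a - f b| <= 1.
  have f1 : \forall b \near a, `|f a - f b| <= 1.
    by move/cvgrPdist_le: (cont_f a); apply.
  have /nbhs_ballP[r /= r0 rP] : \forall b \near a,
      v b - f b <= v a - f a /\ `|f a - f b| <= 1 by exact: filterI maxa f1.
  exists (r / 2); first by rewrite divr_gt0.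
  move=> b ab; apply: rP; split=> // i j; rewrite ord1 /ball /= distrC.
  by apply: le_lt_trans (ab j) _; rewrite ltr_pdivrMr// mulr2n mulrDr mulr1 ltrDl.
pose psi b := f b + \sum_i (b 0 i - a 0 i) ^+ 2.
have psi_f b : f b <= psi b by rewrite lerDl sumr_ge0// => i _; exact: sqr_ge0.
(* Near-maximizers suffice: an excess of [N.+1%:R^-1 ^+ 2] changes the difference
   quotients by [N.+1%:R^-1] only. *)
have /choice[z zP] : forall N, exists z, forall y, box r (lattice_point R N y) ->
    box r (lattice_point R N z) /\
    V N y - psi (lattice_point R N y) <=
    V N z - psi (lattice_point R N z) + N.+1%:R^-1 ^+ 2.
  move=> N.
  have [[y0 y0r]|none] := pselect (exists y, box r (lattice_point R N y)); last first.
    by exists (fun=> 0) => y yr; exfalso; apply: none; exists y.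
  pose E := [set V N y - psi (lattice_point R N y) | y in
    [set y | box r (lattice_point R N y)]].
  have supE : has_sup E.
    split; first by exists (V N y0 - psi (lattice_point R N y0)), y0.
    exists (C - f a + 1) => _ [y yr <-].
    have [_] := rP _ yr; have := psi_f (lattice_point R N y); have := VC N y.
    rewrite !ler_norml => /andP[h1 h2] h3 /andP[h4 h5]; lra.
  have e0 : 0 < (N.+1%:R^-1 : R) ^+ 2 by rewrite exprn_gt0.
  have [_ [z zr <-] hz] := sup_adherent e0 supE; exists z => y yr; split=> //.
  have : V N y - psi (lattice_point R N y) <= sup E.
    by apply: (sup_upper_bound supE); exists y.
  by move: hz; rewrite ltrBlDr => /ltW hz h; exact: le_trans hz.
have hU := @cvg_harmonic_ultra R U UU Uoo.
have near_h (d : R) : 0 < d -> \forall N \near U, (N.+1%:R^-1 : R) <= d.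
  move=> d0; move/cvgrPdist_le: hU => /(_ _ d0); apply: filterS => N.
  by rewrite sub0r normrN ger0_norm.
have near_box : \forall N \near U, box r (lattice_point R N (z N)).
  apply: filterS (near_h _ r0) => N hN.
  have [] := zP N (lattice_floor N a) _ => // i.
  exact: le_trans (lattice_point_floor_dist _ _ _) hN.
have psi_cvg (x : nat -> 'rV[R]_n) b : x @ U --> b -> psi (x N) @[N --> U] --> psi b.
  move=> xb; apply: cvgD; first exact: cvg_comp xb (cont_f b).
  apply: cvg_big => [|i _]; first exact: add_continuous.
  under eq_fun do rewrite expr2.
  by rewrite expr2; apply: cvgM; apply: cvgB; (try exact: cvg_cst); exact: cvg_coord.
have psia : psi a = f a.
  by rewrite /psi big1 ?addr0// => i _; rewrite subrr expr0n.
(* Comparing the near-maximizers with lattice points rounding [a] gives [v a - psi a <= v b - psi b]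
   at their limit [b]; as [v - f] is maximal at [a] in the box, the squares at [b] sum to 0. *)
have xa : lattice_point R N (z N) @[N --> U] --> a.
  have cbox : compact [set b : 'rV[R]_n |
      forall i, `[a 0 i - r, a 0 i + r]%classic (b ord0 i)].
    exact: (@rV_compact R n (fun i => `[a 0 i - r, a 0 i + r]%classic)
      (fun i => @segment_compact R _ _)).
  have near_cbox : \forall N \near U, forall i,
      `[a 0 i - r, a 0 i + r]%classic (lattice_point R N (z N) ord0 i).
    apply: filterS near_box => N h i /=; rewrite in_itv/=.
    by have := h i; rewrite ler_norml => /andP[h1 h2]; apply/andP; split; lra.
  have [b bbox xb] := ultra_cvg_compact UU cbox near_cbox.
  have br : box r b.
    move=> i; have := bbox i; rewrite /= in_itv/= => /andP[h1 h2].
    by rewrite ler_norml; apply/andP; split; lra.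
  suff -> : a = b by [].
  have h : v a - psi a <= v b - psi b + 0.
    have fl := @cvg_lattice_point_floor R n U UU Uoo a.
    have sq : N.+1%:R^-1 ^+ 2 @[N --> U] --> (0 : R).
      by have := cvgM hU hU; rewrite mul0r; apply.
    apply: ler_cvg_to (cvgB (Vv _ _ fl) (psi_cvg _ _ fl))
      (cvgD (cvgB (Vv _ _ xb) (psi_cvg _ _ xb)) sq) _.
    apply: filterS (near_h _ r0) => N hN.
    have [|_ //] := zP N (lattice_floor N a).
    by move=> i; exact: le_trans (lattice_point_floor_dist _ _ _) hN.
  have [h1 _] := rP _ br; rewrite psia addr0 /psi in h.
  have s0 : \sum_i (b 0 i - a 0 i) ^+ 2 = 0.
    apply/eqP; rewrite eq_le sumr_ge0 ?andbT; last by move=> i _; exact: sqr_ge0.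
    lra.
  apply/rowP => i; move/eqP: s0; rewrite psumr_eq0; last by move=> j _; exact: sqr_ge0.
  by move=> /allP/(_ i (mem_index_enum _)) /=; rewrite sqrf_eq0 subr_eq0 => /eqP.
pose e i : 'rV[R]_n := delta_mx 0 i.
pose x N := lattice_point R N (z N).
pose Dp N i := (f (x N + N.+1%:R^-1 *: e i) - f (x N)) / N.+1%:R^-1.
pose Dm N i := (f (x N + - N.+1%:R^-1 *: e i) - f (x N)) / - N.+1%:R^-1.
have gradE i : grad f a 0 i = 'D_(e i) f a by rewrite mxE.
have cD i : {for a, continuous ('D_(e i) f)}.
  have : grad f b 0 i @[b --> a] --> grad f a 0 i by exact: cvg_coord (cf a).
  by rewrite gradE; under eq_fun do rewrite mxE.
have Dp_cvg i : Dp N i @[N --> U] --> grad f a 0 i.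
  by rewrite gradE; apply: cvg_difference_quotient.
have Dm_cvg i : Dm N i @[N --> U] --> grad f a 0 i.
  rewrite gradE; apply: cvg_difference_quotient => //.
  by rewrite -oppr0; apply: cvgN.
(* After division by the step [h], the square contributes [2 * (x - a)] and one [h], near-maximality
   another [h]; the rest are the errors of the difference quotients of [f]. *)
pose o N := \sum_i (`|Dm N i - grad f a 0 i| + `|Dp N i - grad f a 0 i|
  + 2 * `|x N 0 i - a 0 i|) + 2 * N.+1%:R^-1.
have o_ge N i : `|Dm N i - grad f a 0 i| + `|Dp N i - grad f a 0 i|
    + 2 * `|x N 0 i - a 0 i| + 2 * N.+1%:R^-1 <= o N.
  rewrite /o lerD2r (bigD1 i)//= lerDl; apply: sumr_ge0 => j _.
  by rewrite addr_ge0// mulr_ge0.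
exists z, o; split=> //.
- rewrite -[X in _ --> X]addr0; apply: cvgD; last first.
    by rewrite -[X in _ --> X](mulr0 2); apply: cvgMl_tmp.
  rewrite -[X in _ --> X](@big1_eq _ 0 +%R 'I_n (index_enum _) xpredT).
  apply: cvg_big => [|i _]; first exact: add_continuous.
  have sub0 (u : nat -> R) (l : R) : u @ U --> l -> `|u N - l| @[N --> U] --> (0 : R).
    move=> ul; rewrite -[X in _ --> X](normr0 R) -(subrr l).
    by apply: cvg_norm; apply: cvgB => //; exact: cvg_cst.
  rewrite -[X in _ --> X]addr0 -[X in _ --> X + _]addr0.
  apply: cvgD; first by apply: cvgD; exact: sub0.
  rewrite -[X in _ --> X](mulr0 2); apply: cvgMl_tmp; apply: sub0.
  exact: cvg_coord.
- by move=> N; rewrite addr_ge0 ?mulr_ge0// sumr_ge0.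
(* Halving [r] leaves room for one lattice step inside the box. *)
have r2 : 0 < r / 2 by rewrite divr_gt0.
have near_x : \forall N \near U, forall i, `|x N 0 i - a 0 i| <= r / 2.
  apply: filter_forall => i.
  have : x N 0 i @[N --> U] --> a 0 i by exact: cvg_coord.
  by move/cvgrPdist_le => /(_ _ r2); apply: filterS => N; rewrite distrC.
apply: filterS2 near_x (near_h _ r2) => N xr hr i.
have N0 : 0 < N.+1%:R :> R by [].
set h := (N.+1%:R^-1 : R) in hr *.
have h0 : 0 < h by rewrite invr_gt0.
have addE (y : 'rV[R]_n) (k : R) j : (y + k *: e i) 0 j = y 0 j + k * (j == i)%:R.
  by rewrite !mxE.
have step_box (k : int) : `|k%:~R : R| <= 1 ->
    box r (lattice_point R N (lattice_step (z N) i k)).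
  move=> k1 j; rewrite lattice_point_step addE.
  rewrite addrAC; apply: le_trans (ler_normD _ _) _.
  rewrite [r](splitr r) lerD//.
  have ji1 : `|(j == i)%:R : R| <= 1 by case: (j == i); rewrite ?normr1 ?normr0.
  apply: le_trans hr; rewrite !normrM [`|_^-1|]ger0_norm// -/h.
  apply: le_trans (ler_wpM2l _ ji1) _; first by rewrite mulr_ge0// ltW.
  by rewrite mulr1 ler_piMl// ltW.
have psi_step (k : R) : psi (x N + k *: e i) =
    f (x N + k *: e i) + \sum_j (x N 0 j - a 0 j) ^+ 2
    + (2 * (x N 0 i - a 0 i) * k + k ^+ 2).
  rewrite /psi -addrA; congr (_ + _).
  rewrite (bigD1 i)//= [in RHS](bigD1 i)//= addE eqxx mulr1.
  rewrite (eq_bigr (fun j => (x N 0 j - a 0 j) ^+ 2)); first by ring.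
  by move=> j /negbTE ji; rewrite addE ji mulr0 addr0.
have k1 : `|(-1)%:~R : R| <= 1 by rewrite intrN normrN normr1.
have k2 : `|1%:~R : R| <= 1 by rewrite normr1.
have [_] := zP N _ (step_box _ k1); have [_] := zP N _ (step_box _ k2).
have psix : psi (x N) = f (x N) + \sum_j (x N 0 j - a 0 j) ^+ 2 by [].
rewrite !lattice_point_step intrN mulNr !mul1r -/(x N) -/h -/(e i) !psi_step psix.
have [b1 b2 b3] : [/\ `|Dm N i - grad f a 0 i| <= o N - `|Dp N i - grad f a 0 i|
    - 2 * `|x N 0 i - a 0 i| - 2 * h,
  `|Dp N i - grad f a 0 i| <= o N - `|Dm N i - grad f a 0 i|
    - 2 * `|x N 0 i - a 0 i| - 2 * h & True].
  by have := o_ge N i; rewrite -/h; split=> //; lra.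
have hm : h * N.+1%:R = 1 by rewrite mulVf.
have DpE : h * Dp N i = f (x N + h *: e i) - f (x N).
  by rewrite /Dp -/h mulrC divfK// gt_eqF.
have DmE : h * Dm N i = f (x N) - f (x N + - h *: e i).
  by rewrite /Dm -/h invrN mulrN mulrN mulrC divfK ?gt_eqF// opprB.
move: (f (x N + h *: e i)) (f (x N + - h *: e i)) DpE DmE => fp fm DpE DmE.
move: (\sum_j _) => S hp hmm.
have s1 := ler_norm (x N 0 i - a 0 i).
have s2 := ler_norm (- (x N 0 i - a 0 i)); rewrite normrN in s2.
have d1 := ler_norm (Dp N i - grad f a 0 i).
have d2 := ler_norm (- (Dm N i - grad f a 0 i)); rewrite normrN in d2.
have n1 := normr_ge0 (Dp N i - grad f a 0 i).
have n2 := normr_ge0 (Dm N i - grad f a 0 i).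
have bE : h * bwd N (V N) (z N) i = V N (z N) - V N (lattice_step (z N) i (-1)).
  by rewrite /bwd mulrA hm mul1r.
have fE : h * fwd N (V N) (z N) i = V N (lattice_step (z N) i 1) - V N (z N).
  by rewrite /fwd mulrA hm mul1r.
split; rewrite -(ler_pM2l h0) ?bE ?fE.
  have q : grad f a 0 i - o N <= Dm N i + 2 * (x N 0 i - a 0 i) - 2 * h by lra.
  have := ler_wpM2l (ltW h0) q; move: hmm DmE; lra.
have q : Dp N i + 2 * (x N 0 i - a 0 i) + 2 * h <= grad f a 0 i + o N by lra.
by have := ler_wpM2l (ltW h0) q; move: hp DpE; lra.
Qed.

End TestPoint.

(** * The limit equation in the viscosity sense *)

Section ViscosityLimit.
Context (R : realType) (n : nat) (K : torus R n -> R -> 'rV[R]_n -> R).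
Context (U : set_system nat) (UU : UltraFilter U) (Uoo : \oo `<=` U).
Context (w : R -> R) (A L C c : R) (V : nat -> ('I_n -> int) -> R) (cN : nat -> R).
Context (v : 'rV[R]_n -> R).
Hypothesis w0 : w 0 = 0.
Hypothesis w_mono : forall s t : R, s <= t -> w s <= w t.
Hypothesis wD : forall s t : R, 0 <= s -> 0 <= t -> w (s + t) <= w s + w t.
Hypothesis w_cvg : forall (u : nat -> R) (l : R), (forall k, 0 <= u k) -> 0 <= l ->
  u @ U --> l -> w (u k) @[k --> U] --> w l.
Hypothesis K_cvg : forall (x : nat -> torus R n) y (r : nat -> R) (l : R)
  (p : nat -> 'rV[R]_n) (q : 'rV[R]_n), x @ U --> y ->
  r @ U --> l -> p @ U --> q -> K (x k) (r k) (p k) @[k --> U] --> K y l q.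
Hypothesis K_mod : forall x r (p q : 'rV[R]_n) (t : R),
  (forall i, `|p 0 i - q 0 i| <= t) -> `|K x r p - K x r q| <= w t.
Hypothesis A0 : 0 < A.
Hypothesis V_bound : forall N z, 0 <= V N z <= C.
Hypothesis V_lip : forall N z i,
  `|V N (lattice_step z i 1) - V N z| <= (L + 1) / N.+1%:R.
Hypothesis V_scheme : forall N z, scheme K w A L N (V N) z = cN N.
Hypothesis cN_cvg : cN @ U --> c.
Hypothesis V_cvg : forall z a, lattice_point R N (z N) @[N --> U] --> a ->
  V N (z N) @[N --> U] --> v a.

Let slope N z i : `|fwd N (V N) z i| <= L + 1 /\ `|bwd N (V N) z i| <= L + 1.
Proof.
have h y : `|fwd N (V N) y i| <= L + 1.
  by rewrite /fwd normrM ger0_norm// mulrC -ler_pdivlMr//; exact: V_lip.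
split=> //; have := h (lattice_step z i (-1)); rewrite /fwd /bwd.
by have := lattice_stepK z i (-1); rewrite opprK => ->.
Qed.

Let K_point (z : nat -> 'I_n -> int) a p : lattice_point R N (z N) @[N --> U] --> a ->
  K (torus_proj (lattice_point R N (z N))) (V N (z N)) p @[N --> U] -->
  K (torus_proj a) (v a) p.
Proof.
move=> za; apply: K_cvg; [|exact: V_cvg|exact: cvg_cst].
exact: cvg_comp za (@torus_proj_continuous R n a).
Qed.

Let error_cvg (o : nat -> R) : (forall N, 0 <= o N) -> o @ U --> (0 : R) ->
  w (o N) + n%:R * w (2 * o N) @[N --> U] --> (0 : R).
Proof.
move=> o0 ecvg; rewrite -[X in _ --> X]addr0; apply: cvgD.
  by rewrite -w0; apply: w_cvg.
rewrite -[X in _ --> X](mulr0 n%:R); apply: cvgMl_tmp; rewrite -w0.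
apply: w_cvg => // [N|]; first by rewrite mulr_ge0.
by rewrite -[X in _ --> X](mulr0 2); apply: cvgMl_tmp.
Qed.

Let le_of_near (s t : R) (o : nat -> R) : o @ U --> (0 : R) ->
  (\forall N \near U, s <= t + o N) -> s <= t.
Proof.
move=> ecvg st; apply: ler_cvg_to (cvg_cst s) _ st.
by rewrite -[X in _ --> X]addr0; apply: cvgD => //; exact: cvg_cst.
Qed.

Lemma limit_subsolution (f : 'rV[R]_n -> R) a :
  (forall b, differentiable f b) -> continuous (grad f) ->
  (\forall b \near a, v b - f b <= v a - f a) ->
  (forall i, `|grad f a 0 i| <= L + 1) /\ K (torus_proj a) (v a) (grad f a) <= c.
Proof.
move=> df cf maxa.
have VC N z : `|V N z| <= C.
  by have /andP[h1 h2] := V_bound N z; rewrite ger0_norm.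
have [z [err [ecvg e0 za oP]]] := test_point UU Uoo VC V_cvg df cf maxa.
split=> [i|].
  rewrite ler_norml; apply/andP; split.
    rewrite lerNl; apply: (le_of_near ecvg); apply: filterS oP => N /(_ i)[_].
    by have [] := slope N (z N) i; rewrite ler_norml => /andP[h1 h2] _ h3; lra.
  apply: (le_of_near ecvg); apply: filterS oP => N /(_ i)[+ _].
  by have [_] := slope N (z N) i; rewrite ler_norml => /andP[h1 h2] h3; lra.
rewrite -[leLHS]subr0.
apply: ler_cvg_to (cvgB (K_point (p := grad f a) za) (error_cvg e0 ecvg)) cN_cvg _.
apply: filterS oP => N oP; rewrite -(V_scheme N (z N)) /scheme.
apply: (@le_trans _ _ (numham w (K (torus_proj (lattice_point R N (z N)))
    (V N (z N))) (bwd N (V N) (z N)) (fwd N (V N) (z N)))).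
  apply: numham_ge => //; first by move=> q t; exact: K_mod.
    by move=> i; have [] := oP i.
  by move=> i; have [] := oP i.
rewrite lerDl; apply: mulr_ge0; first exact: ltW.
by apply: sumr_ge0 => i _; rewrite addr_ge0// le_max lexx orbT.
Qed.

(** The contact argument for [- V] and [- f]. The penalty now has the wrong sign, but a gradient
    below [L] makes it vanish eventually at the contact points; steeper gradients are left to
    coercivity. *)
Lemma limit_supersolution (f : 'rV[R]_n -> R) a :
  (forall b, differentiable f b) -> continuous (grad f) ->
  (\forall b \near a, v a - f a <= v b - f b) ->
  (forall i, `|grad f a 0 i| < L) -> c <= K (torus_proj a) (v a) (grad f a).
Proof.
move=> df cf mina gL.
have VC N z : `|- V N z| <= C.
  by have /andP[h1 h2] := V_bound N z; rewrite normrN ger0_norm.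
have V_cvg' z b : lattice_point R N (z N) @[N --> U] --> b ->
    - V N (z N) @[N --> U] --> - v b.
  by move=> zb; apply: cvgN; exact: V_cvg.
have df' b : differentiable (fun b => - f b) b by exact: differentiableN.
have gN b : grad (fun b => - f b) b = - grad f b.
  by apply/rowP => i; rewrite !mxE deriveN//; exact: diff_derivable.
have cf' : continuous (grad (fun b => - f b)).
  rewrite (_ : grad _ = fun b => - grad f b); last exact/funext.
  by move=> b; exact: cvgN (cf b).
have maxa : \forall b \near a, - v b - - f b <= - v a - - f a.
  by apply: filterS mina => b; lra.
have [z [err [ecvg e0 za oP]]] :=
  test_point (V := fun N z => - V N z) UU Uoo VC V_cvg' df' cf' maxa.
have {}oP : \forall N \near U, forall i,
    bwd N (V N) (z N) i <= grad f a 0 i + err N /\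
    grad f a 0 i - err N <= fwd N (V N) (z N) i.
  apply: filterS oP => N oP i; have := oP i; rewrite gN mxE /bwd /fwd.
  by move=> [h1 h2]; split; lra.
have small : \forall N \near U, forall i, `|grad f a 0 i| + err N <= L.
  apply: filter_forall => i.
  have d0 : 0 < L - `|grad f a 0 i| by rewrite subr_gt0.
  move/cvgrPdist_le: ecvg => /(_ _ d0); apply: filterS => N.
  by rewrite sub0r normrN ger0_norm//; lra.
rewrite -[leRHS]addr0.
apply: ler_cvg_to cN_cvg (cvgD (K_point (p := grad f a) za) (error_cvg e0 ecvg)) _.
apply: filterS2 oP small => N oP small; rewrite -(V_scheme N (z N)) /scheme.
rewrite /slope_penalty big1 ?mulr0 ?addr0; last first.
  move=> i _; have [h1 h2] := oP i; have h3 := small i.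
  have := ler_norm (grad f a 0 i); have := ler_norm (- grad f a 0 i).
  by rewrite normrN => h4 h5; rewrite !max_r ?addr0//; lra.
apply: numham_le => //; first by move=> q t; exact: K_mod.
  by move=> i; have [] := oP i.
by move=> i; have [] := oP i.
Qed.

End ViscosityLimit.

(** * Truncation of the Hamiltonian *)

Section Truncation.
Context (R : realType) (n : nat) (H : torus R n -> R -> 'rV[R]_n -> R).
Hypothesis H_cont : continuous (fun z : torus R n * R * 'rV[R]_n => H z.1.1 z.1.2 z.2).

Definition clip (a b x : R) : R := Num.max a (Num.min b x).

Lemma clip_itv a b x : a <= b -> a <= clip a b x <= b.
Proof. by move=> ab; rewrite /clip le_max lexx ge_max ab ge_min lexx. Qed.

Lemma clip_id a b x : a <= x <= b -> clip a b x = x.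
Proof. by move=> /andP[ax xb]; rewrite /clip min_r// max_r. Qed.

Lemma clip_lipschitz a b x y : `|clip a b x - clip a b y| <= `|x - y|.
Proof.
rewrite /clip; have := ler_norm (x - y); have := ler_norm (- (x - y)).
rewrite normrN ler_norml => h1 h2.
case: (leP b x) => ?; case: (leP b y) => ?; case: (leP a b) => ?;
case: (leP a x) => ?; case: (leP a y) => ?; apply/andP; split; lra.
Qed.

Lemma clip_cvg (F : set_system nat) (FF : Filter F) a b (u : nat -> R) (l : R) :
  u @ F --> l -> clip a b (u k) @[k --> F] --> clip a b l.
Proof.
move=> ul; apply: cvg_maxr; first exact: cvg_cst.
rewrite minr_absE; under eq_fun do rewrite minr_absE.
apply: cvgMr_tmp; apply: cvgB; first by apply: cvgD => //; exact: cvg_cst.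
by apply: cvg_norm; apply: cvgB => //; exact: cvg_cst.
Qed.

Definition clip_row (P : R) (p : 'rV[R]_n) : 'rV[R]_n := \row_i clip (- P) P (p 0 i).

Definition truncation (C P : R) x r p : R := H x (clip 0 C r) (clip_row P p).

Lemma H_cvg (F : set_system nat) (FF : Filter F) (x : nat -> torus R n) y
    (r : nat -> R) (l : R) (p : nat -> 'rV[R]_n) (q : 'rV[R]_n) :
  x @ F --> y -> r @ F --> l -> p @ F --> q -> H (x k) (r k) (p k) @[k --> F] --> H y l q.
Proof.
move=> xy rl pq.
have xrp : (x k, r k, p k) @[k --> F] --> (y, l, q).
  exact: cvg_pair (cvg_pair xy rl) pq.
exact: (cvg_comp _ _ xrp (@H_cont (y, l, q))).
Qed.

Lemma clip_row_cvg (F : set_system nat) (FF : Filter F) P (p : nat -> 'rV[R]_n) q :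
  p @ F --> q -> clip_row P (p k) @[k --> F] --> clip_row P q.
Proof.
move=> pq; apply: cvg_row => i; rewrite mxE; under eq_fun do rewrite mxE.
by apply: clip_cvg; exact: cvg_coord.
Qed.

Lemma truncation_cvg C P (F : set_system nat) (FF : Filter F) (x : nat -> torus R n) y
    (r : nat -> R) (l : R) (p : nat -> 'rV[R]_n) (q : 'rV[R]_n) :
  x @ F --> y -> r @ F --> l -> p @ F --> q ->
  truncation C P (x k) (r k) (p k) @[k --> F] --> truncation C P y l q.
Proof.
move=> xy rl pq; apply: H_cvg => //; first exact: clip_cvg.
exact: clip_row_cvg.
Qed.

Lemma clip_row_compact P : 0 <= P ->
  exists2 B : set 'rV[R]_n, compact B & forall p, B (clip_row P p).
Proof.
move=> P0; exists [set b : 'rV[R]_n | forall i, `[- P, P]%classic (b ord0 i)].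
  exact: (@rV_compact R n (fun i => `[- P, P]%classic) (fun i => @segment_compact R _ _)).
by move=> p i; rewrite mxE /= in_itv/= clip_itv// ge0_cp.
Qed.

Lemma truncation_bound C P : 0 <= C -> 0 <= P ->
  exists2 M : R, 0 <= M & forall x r p, `|truncation C P x r p| <= M.
Proof.
move=> C0 P0; have [B cB Bp] := clip_row_compact P0.
have cA := compact_setX (compact_setX (@torus_compact R n) (@segment_compact R 0 C)) cB.
have := compact_bounded (continuous_compact (continuous_subspaceT H_cont) cA).
move=> [M0 [_ hM]]; exists (`|M0| + 1); first by rewrite addr_ge0.
move=> x r p; apply: (hM (`|M0| + 1)); first by have := ler_norm M0; lra.
exists (x, clip 0 C r, clip_row P p) => //=.
by split; [split|] => //=; rewrite in_itv/= clip_itv.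
Qed.

(** Uniform continuity on a compact set, by contradiction: the clipped data of a sequence of bad
    pairs converge along [U], both momenta to the same limit. *)
Lemma truncation_equicontinuous C P (U : set_system nat) (UU : UltraFilter U)
    (Uoo : \oo `<=` U) : 0 <= C -> 0 <= P ->
  forall e : R, 0 < e -> exists2 d : R, 0 < d &
  forall x r (p q : 'rV[R]_n), (forall i, `|p 0 i - q 0 i| <= d) ->
    `|truncation C P x r p - truncation C P x r q| <= e.
Proof.
move=> C0 P0 e e0; apply: contrapT => none.
have /choice[t tP] : forall k : nat, exists t : torus R n * R * ('rV[R]_n * 'rV[R]_n),
    (forall i, `|t.2.1 0 i - t.2.2 0 i| <= k.+1%:R^-1) /\
    e < `|truncation C P t.1.1 t.1.2 t.2.1 - truncation C P t.1.1 t.1.2 t.2.2|.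
  move=> k; apply: contrapT => h; apply: none; exists k.+1%:R^-1 => //.
  move=> x r p q pq; rewrite leNgt; apply/negP => he; apply: h.
  by exists (x, r, (p, q)).
have [B cB Bp] := clip_row_compact P0.
have nearT (Q : nat -> Prop) : (forall k, Q k) -> \forall k \near U, Q k.
  by move=> h; apply: nearW.
have [x _ xU] := ultra_cvg_compact UU (@torus_compact R n)
  (nearT (fun k => [set: torus R n] (t k).1.1) (fun k => I)).
have [r _ rU] := ultra_cvg_itv UU (fun k => @clip_itv 0 C (t k).1.2 C0).
have [p _ pU] := ultra_cvg_compact UU cB (nearT _ (fun k => Bp (t k).2.1)).
have [q _ qU] := ultra_cvg_compact UU cB (nearT _ (fun k => Bp (t k).2.2)).
have pq : p = q.
  apply/rowP => i; apply/eqP; rewrite -subr_eq0 -normr_le0.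
  have hU := @cvg_harmonic_ultra R U UU Uoo.
  apply: ler_cvg_to (cvg_norm (cvgB (cvg_coord _ pU) (cvg_coord _ qU))) hU _.
  apply: nearW => k; have [/(_ i) h _] := tP k.
  apply: le_trans h.
  change (`|clip_row P (t k).2.1 0 i - clip_row P (t k).2.2 0 i| <=
    `|(t k).2.1 0 i - (t k).2.2 0 i|).
  by rewrite !mxE; exact: clip_lipschitz.
have : e <= 0.
  rewrite -(normr0 R) -(subrr (H x r p)) {2}pq.
  apply: ler_cvg_to (cvg_cst e) (cvg_norm (cvgB (H_cvg _ xU rU pU) (H_cvg _ xU rU qU))) _.
  by apply: nearW => k; have [_ /ltW] := tP k.
by rewrite leNgt e0.
Qed.

End Truncation.

(** * Existence of a solution *)

Lemma modulus0 (R : realType) (T : Type) (n : nat) (G : T -> 'rV[R]_n -> R) (M : R) :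
  (forall x p, `|G x p| <= M) -> 0 <= M -> modulus G 0 = 0.
Proof.
move=> GM M0; apply/eqP; rewrite eq_le (modulus_ge0 GM)// andbT.
apply: modulus_le => // x p q pq.
have -> : p = q.
  by apply/rowP => i; apply/eqP; rewrite -subr_eq0 -normr_le0.
by rewrite subrr normr0.
Qed.

(** * From periodic functions to functions on the torus *)

Section TorusFunctions.
Context (R : realType) (n : nat).

Lemma le_enorm (p : 'rV[R]_n) i : `|p 0 i| <= enorm p.
Proof.
rewrite -sqrtr_sqr; apply: ler_wsqrtr.
by rewrite (bigD1 i)//= lerDl sumr_ge0// => j _; exact: sqr_ge0.
Qed.

Variable v : 'rV[R]_n -> R.
Hypothesis v_per : forall a b : 'rV[R]_n,
  (forall i, a 0 i - b 0 i \is a Num.int) -> v a = v b.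

Definition descent (x : torus R n) : R := v (repr x).

Lemma descentE a : descent (torus_proj a) = v a.
Proof. by apply: v_per; apply/torus_projP; rewrite torus_proj_repr. Qed.

Context (l : R).
Hypothesis l0 : 0 <= l.
Hypothesis v_lip : forall a b : 'rV[R]_n, `|v a - v b| <= l * \sum_i `|a 0 i - b 0 i|.

Lemma descent_lipschitz : torus_lipschitz descent.
Proof.
(* Passing from the sum of coordinates to the Euclidean norm costs a factor [n]; the added 1 makes
   the constant positive, so that one can divide by it. *)
exists (l * n%:R + 1) => x y.
have L0 : 0 < l * n%:R + 1 by rewrite ltr_wpDl// mulr_ge0.
rewrite mulrC -ler_pdivrMr//; apply: lb_le_inf.
  exists (enorm (repr x - repr y)), (repr x); first exact: torus_proj_repr.
  by exists (repr y) => //; exact: torus_proj_repr.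
move=> _ [a <- [b <- <-]]; rewrite !descentE ler_pdivrMr//.
have e0 : 0 <= enorm (a - b) by exact: sqrtr_ge0.
have sum_le : \sum_i `|a 0 i - b 0 i| <= n%:R * enorm (a - b).
  rewrite mulr_natl -[n in _ *+ n]card_ord -sumr_const.
  by apply: ler_sum => i _; have := le_enorm (a - b) i; rewrite !mxE.
apply: le_trans (v_lip _ _) (le_trans (ler_wpM2l l0 sum_le) _).
by rewrite mulrDr mulr1 mulrA [leRHS]addrC mulrC lerDr.
Qed.

Lemma descent_continuous : continuous descent.
Proof.
have v_cont : continuous v.
  move=> a; have FF : Filter (nbhs a) := nbhs_filter a.
  apply/cvgrPdist_le => e e0.
  have h : l * \sum_i `|a 0 i - b 0 i| @[b --> a] --> (0 : R).
    rewrite -[X in _ --> X](mulr0 l); apply: cvgMl_tmp.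
    rewrite -[X in _ --> X](@big1_eq _ 0 +%R 'I_n (index_enum _) xpredT).
    apply: cvg_big => [|i _]; first exact: add_continuous.
    rewrite -[X in _ --> X](normr0 R) -(subrr (a 0 i)).
    by apply: cvg_norm; apply: cvgB; [exact: cvg_cst|exact: coord_continuous].
  move/cvgrPdist_le: h => /(_ _ e0); apply: (@filterS _ _ FF) => b.
  rewrite sub0r normrN => h; apply: le_trans (v_lip a b) (le_trans (ler_norm _) h).
apply/quotient_continuous; rewrite (_ : descent \o _ = v)//.
by apply/funext => a; exact: descentE.
Qed.

Lemma near_torus_proj (P : torus R n -> Prop) (a : 'rV[R]_n) :
  (\forall y \near torus_proj a, P y) -> \forall b \near a, P (torus_proj b).
Proof. exact: torus_proj_continuous. Qed.

End TorusFunctions.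

Unset Implicit Arguments.

Theorem theorem1p2 (R : realType) (n : nat)
  (H : torus R n -> R -> 'rV[R]_n -> R)
  (H_cont : continuous (fun z : torus R n * R * 'rV[R]_n => H z.1.1 z.1.2 z.2))
  (H_lip : exists2 C1 : R, 0 < C1 &
     forall (x : torus R n) (p : 'rV[R]_n) (r s : R),
       `|H x r p - H x s p| <= C1 * `|r - s|)
  (H_superlinear : forall M : R, exists K : R,
     forall (x : torus R n) (p : 'rV[R]_n),
       K < enorm p -> M < H x 0 p / enorm p) :
  exists (v : torus R n -> R) (c : R),
    torus_lipschitz v /\ viscosity_solution H c v.
Proof.
have [U [UU Uoo]] := ultraFilterLemma (@eventually_filter : ProperFilter \oo).
have [C1 C10 HC1] := H_lip.
(* Clipping everything to 0 yields a bound on [H x 0 0] uniform in [x]. *)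
have [M0 M00 HM0] := truncation_bound H_cont (lexx 0) (lexx 0).
have H00 x : `|H x 0 0| <= M0.
  have := HM0 x 0 0; rewrite /truncation clip_id ?lexx//.
  rewrite (_ : clip_row 0 0 = 0)//; apply/rowP => i.
  by rewrite !mxE clip_id// oppr0 lexx.
have n0 : 0 <= n%:R :> R by [].
(* The threshold is set for [coercive]: as [1 <= L], twice [C] is at most [(8 * n + 2) * L], and
   [C1 * C] is spent twice, in [c0] and in passing from the value 0 to [r]. *)
have [k0 Hk0] := H_superlinear (M0 + C1 * (8 * n%:R + 2)).
pose L := Num.max k0 0 + 1.
have L1 : 1 <= L by rewrite lerDr le_max lexx orbT.
have k0L : k0 < L by rewrite ltr_pwDr// le_max lexx.
have L0 : 0 <= L by exact: le_trans L1.
(* The bound on the discrete solutions: their mean, chosen 1 above the bound on the oscillation,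
   plus that bound. *)
pose C := n%:R * (L + 1) + 1 + n%:R * (L + 1).
have nL0 : 0 <= n%:R * (L + 1) by rewrite mulr_ge0// addr_ge0.
have C0 : 0 <= C by rewrite !addr_ge0.
pose P := L + 1; have P0 : 0 <= P by rewrite addr_ge0.
pose c0 : R := M0 + C1 * C.
(* This is where the superlinear growth enters: slopes up to [L + 1] allow values
   of size [C], linear in [L], which perturb the Hamiltonian by [C1 * C] only. *)
have coercive x (r : R) (p : 'rV[R]_n) i : 0 <= r <= C -> L <= `|p 0 i| -> c0 <= H x r p.
  move=> /andP[r0 rC] Lp; have ep := le_trans Lp (le_enorm p i).
  have e0 : 0 < enorm p by apply: lt_le_trans ep; exact: lt_le_trans L1.
  have := Hk0 x p (lt_le_trans k0L ep); rewrite ltr_pdivlMr// => h1.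
  have h2 := HC1 x p r 0; rewrite subr0 (ger0_norm r0) ler_norml in h2.
  have h3 : C1 * r <= C1 * C by rewrite ler_pM2l.
  have h4 : (M0 + C1 * (8 * n%:R + 2)) * L <= (M0 + C1 * (8 * n%:R + 2)) * enorm p.
    by rewrite ler_wpM2l// addr_ge0// mulr_ge0 ?addr_ge0 ?mulr_ge0// ltW.
  have h5 : M0 <= M0 * L by rewrite ler_peMr.
  have h6 : 2 * C <= (8 * n%:R + 2) * L.
    have h7 : n%:R <= n%:R * L by rewrite ler_peMr.
    by rewrite /C; lra.
  have h8 : C1 * (2 * C) <= C1 * ((8 * n%:R + 2) * L) by rewrite ler_pM2l.
  by move/andP: h2 => [h2 _]; rewrite /c0; lra.
pose K := truncation H C P.
have [M M_ge0 KM] := truncation_bound H_cont C0 P0.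
(* Pairing [x] with [r] makes the modulus uniform in both. *)
pose G (xr : torus R n * R) (p : 'rV[R]_n) := K xr.1 xr.2 p.
have GM xr p : `|G xr p| <= M by exact: KM.
have Geq (e : R) : 0 < e -> exists2 d : R, 0 < d & forall x (p q : 'rV[R]_n),
    (forall i, `|p 0 i - q 0 i| <= d) -> `|G x p - G x q| <= e.
  move=> e0; have [d d0 hd] := truncation_equicontinuous H_cont UU Uoo C0 P0 e0.
  by exists d => // x p q; exact: hd.
pose w := modulus G.
have w_ge0 t : 0 <= w t by exact: modulus_ge0 GM _ M_ge0.
have w_le t : w t <= M + M by exact: modulus_le_bound GM _ M_ge0.
have w_0 : w 0 = 0 by exact: modulus0 GM M_ge0.
have w_mono s t : s <= t -> w s <= w t by exact: modulus_mono GM _ _ M_ge0.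
have wD s t : 0 <= s -> 0 <= t -> w (s + t) <= w s + w t.
  exact: modulusD GM _ _ M_ge0.
have w_cvg (u : nat -> R) (l : R) : (forall k, 0 <= u k) -> 0 <= l ->
    u @ U --> l -> w (u k) @[k --> U] --> w l.
  exact: (modulus_cvg GM Geq _ M_ge0).
have K_cvg (x : nat -> torus R n) y (r : nat -> R) (l : R)
    (p : nat -> 'rV[R]_n) (q : 'rV[R]_n) : x @ U --> y ->
    r @ U --> l -> p @ U --> q -> K (x k) (r k) (p k) @[k --> U] --> K y l q.
  exact: truncation_cvg.
have K_mod x r (p q : 'rV[R]_n) t :
    (forall i, `|p 0 i - q 0 i| <= t) -> `|K x r p - K x r q| <= w t.
  by move=> pq; apply: (le_modulus GM (x, r) M_ge0 pq).
have K0_le x r : K x r 0 <= c0.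
  have cr := clip_itv r C0; have /andP[cr0 crC] := cr.
  rewrite /K /truncation (_ : clip_row P 0 = 0); last first.
    by apply/rowP => i; rewrite !mxE clip_id// oppr_le0 P0.
  have := HC1 x 0 (clip 0 C r) 0; rewrite subr0 (ger0_norm cr0).
  have h3 : C1 * clip 0 C r <= C1 * C by rewrite ler_pM2l.
  have := H00 x; rewrite !ler_norml /c0 => /andP[h1 h2] /andP[h4 h5]; lra.
pose A := c0 + (M + n%:R * (M + M)) + 1.
have c00 : 0 <= c0 by rewrite addr_ge0// mulr_ge0// ltW.
have A0 : 0 < A by rewrite ltr_wpDl// addr_ge0// addr_ge0// mulr_ge0// addr_ge0.
have A_ge : c0 + (M + n%:R * (M + M)) <= A by rewrite lerDl.
have B_gt : n%:R * (L + 1) < n%:R * (L + 1) + 1 by rewrite ltrDl.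
have K_cvg' x (r : nat -> R) (l : R) (p : nat -> 'rV[R]_n) (q : 'rV[R]_n) :
    r @ U --> l -> p @ U --> q -> K x (r k) (p k) @[k --> U] --> K x l q.
  by apply: K_cvg; exact: cvg_cst.
have /choice[V VP] := fun N => discrete_solution N UU Uoo w_ge0 w_le w_0 w_mono wD w_cvg
  K_cvg' K_mod KM K0_le L0 A0 A_ge B_gt.
have /choice[cN cNP] := VP.
have V_per N : lattice_periodic N (V N) by have [] := cNP N.
have V_bound N z : 0 <= V N z <= C by have [] := cNP N.
have V_lip N z i : `|V N (lattice_step z i 1) - V N z| <= (L + 1) / N.+1%:R.
  by have [] := cNP N.
have V_scheme N z : scheme K w A L N (V N) z = cN N by have [] := cNP N.
have [c /andP[_ cc0] cN_cvg] := ultra_cvg_itv UU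
  (fun N => let: And5 _ _ _ _ h := cNP N in h).
have [v [V_cvg vC v_lip v_per]] := lattice_limit UU Uoo V_bound P0 V_lip V_per.
have rx (x : torus R n) : torus_proj (repr x) = x by exact: torus_proj_repr.
exists (descent v), c; split; first exact: (descent_lipschitz v_per P0 v_lip).
split; first exact: (descent_continuous v_per v_lip).
- move=> phi x [dphi cphi] xmax; pose f := Defs.lift phi.
  have maxa : \forall b \near repr x, v b - f b <= v (repr x) - f (repr x).
    have := near_torus_proj (a := repr x) _; rewrite rx => /(_ _ xmax).
    by apply: filterS => b; rewrite /f /Defs.lift /= descentE// rx.
  have [pL] := limit_subsolution UU Uoo w_0 w_mono wD w_cvg K_cvg K_mod A0 V_bound
    V_lip V_scheme cN_cvg V_cvg dphi cphi maxa.
  (* The partial derivatives are at most [L + 1 = P] in size and [v] takes values in [[0, C]], so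
     the truncation is not seen. *)
  rewrite rx /K /truncation clip_id// /torus_grad -/f
      (_ : clip_row _ _ = grad f (repr x))//.
  by apply/rowP => i; rewrite mxE clip_id// -ler_norml.
- move=> phi x [dphi cphi] xmin; pose f := Defs.lift phi.
  have mina : \forall b \near repr x, v (repr x) - f (repr x) <= v b - f b.
    have := near_torus_proj (a := repr x) _; rewrite rx => /(_ _ xmin).
    by apply: filterS => b; rewrite /f /Defs.lift /= descentE// rx.
  have [small|] := pselect (forall i, `|grad f (repr x) 0 i| < L).
    have := limit_supersolution UU Uoo w_0 w_mono wD w_cvg K_cvg K_mod V_bound
      V_scheme cN_cvg V_cvg dphi cphi mina small.
    rewrite rx /K /truncation clip_id// /torus_grad -/f
      (_ : clip_row _ _ = grad f (repr x))//.
    apply/rowP => i; rewrite mxE clip_id// -ler_norml.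
    by apply: le_trans (ltW (small i)) _; rewrite lerDl.
  (* At steep gradients the inequality comes from [H] itself: [c <= c0] is inherited from the
     scheme, and [c0] is at most [H] by coercivity. *)
  move=> /existsNP[i /negP]; rewrite -leNgt => Li; apply: le_trans cc0 _.
  exact: (coercive x _ (grad f (repr x)) i (vC _) Li).
Qed.
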